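(* Let $k$ be an algebraically closed field. For every integer $n\ge 1$, a set of $n$ general points in $\mathbb{P}^2_k$ can be obtained from a single point by a (finite) sequence of ascending elementary biliaisons.
   Context: ''A general $X$ has property $Y$'' means that there is a nonempty Zariski open subset of the family of all $X$'s having property $Y$; here the $X$'s are the reduced sets of $n$ points of $\mathbb{P}^2$. A closed subscheme $S\subseteq\mathbb{P}^m$ is arithmetically Cohen--Macaulay (ACM) if its homogeneous coordinate ring is Cohen--Macaulay. It satisfies $G_1$ if its local rings of dimension $\le 1$ are Gorenstein. Let $S$ be an ACM scheme of dimension $r+1$ satisfying $G_1$, with hyperplane class $H$. Effective (generalized) divisors on $S$ are closed subschemes of $S$ of pure dimension $r$ without embedded components. For effective divisors $V_1,V_2$ on $S$ and $h\in\mathbb{Z}$, write $V_2\in|V_1+hH|$ if $V_2$ is linearly equivalent to $V_1+hH$, i.e. $\mathcal{I}_{V_2,S}\cong\mathcal{I}_{V_1,S}(-h)$ as $\mathcal{O}_S$-modules. In this case $V_2$ is said to be obtained from $V_1$ by an elementary (Gorenstein) biliaison of height $h$ (on $S$); it is ascending if $h\ge 0$. For points in $\mathbb{P}^2$ (so $r=0$) the schemes $S$ are plane curves. *)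

(* Defs.v *)
From HB Require Import structures.
From mathcomp Require Import all_boot all_order all_algebra.
From mathcomp Require Export mpoly.

Set Implicit Arguments.
Unset Strict Implicit.
Unset Printing Implicit Defensive.

Import GRing.Theory.
Local Open Scope ring_scope.

(* Closed subschemes of P^2 over k are encoded by their saturated homogeneous
   ideals in k[x_0,x_1,x_2].  Ideals are Prop-valued predicates, since ideal
   membership is not given by a boolean over an arbitrary field. *)
Record closed_subscheme (k : fieldType) := ClosedSubscheme {
  hideal :> {mpoly k[3]} -> Prop;
  hideal0 : hideal 0;
  hidealD : forall F G, hideal F -> hideal G -> hideal (F + G);
  hidealM : forall F G, hideal G -> hideal (F * G);
  hideal_homog : forall d F, hideal F -> hideal (pihomog mdeg d F);
  hideal_sat : forall F,
    (forall j : 'I_3, exists N : nat, hideal ('X_j ^+ N * F)) -> hideal F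
}.

(* V is contained in W as a subscheme when the ideal of W is contained in the
   ideal of V. *)
Definition subscheme (k : fieldType) (V W : closed_subscheme k) : Prop :=
  forall F, W F -> V F.

Definition same_scheme (k : fieldType) (V W : closed_subscheme k) : Prop :=
  forall F, V F <-> W F.

(* The ACM one-dimensional closed subschemes of P^2, possibly reducible or
   nonreduced; being hypersurfaces, they are Gorenstein. *)
Definition plane_curve (k : fieldType) (S : closed_subscheme k) : Prop :=
  exists d (f : {mpoly k[3]}),
    [/\ (0 < d)%N, f != 0, f \is d.-homog
      & forall F, S F <-> exists G, F = G * f].

(* A saturated homogeneous ideal is prime iff it is a homogeneous prime not
   containing (x_0,x_1,x_2), i.e. iff it is a point of the scheme P^2. *)
Definition integral (k : fieldType) (P : closed_subscheme k) : Prop :=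
  ~ P 1 /\ forall F G, P (F * G) -> P F \/ P G.

(* V is nonempty and has no chain of two distinct integral closed subschemes.
   Every point of such a V is closed, so every irreducible component has
   dimension 0 and there is no embedded component. *)
Definition pure_dim0 (k : fieldType) (V : closed_subscheme k) : Prop :=
  ~ V 1 /\
  forall P Q : closed_subscheme k, integral P -> integral Q ->
    subscheme Q P -> subscheme P V -> same_scheme P Q.

Definition effective_divisor (k : fieldType) (S V : closed_subscheme k) : Prop :=
  subscheme V S /\ pure_dim0 V.

(* For homogeneous g <> 0 of degree d > 0, the pair s = (a, m) stands for the
   fraction a / g ^ m.  Let J be a homogeneous ideal containing the ideal I_S.
   Sections over S \cap D_+(g) of the sheaf (J / I_S)(t) are the elements of
   degree t of (J / I_S)_g: the fractions satisfying [is_section], up to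
   [eq_section].  J = (1) and t = 0 give O_S; J = the ideal of V and t = - h
   give I_{V,S}(-h). *)
Section Sections.
Variable k : fieldType.
Local Notation R := {mpoly k[3]}.

Definition is_section (J : R -> Prop) (t : int) (d : nat) (s : R * nat) : Prop :=
  J s.1 /\ exists e : nat, s.1 \is e.-homog /\ (e%:Z = (s.2 * d)%N%:Z + t)%R.

Definition eq_section (S : closed_subscheme k) (g : R) (s s' : R * nat) : Prop :=
  exists N : nat, S (g ^+ N * (g ^+ s'.2 * s.1 - g ^+ s.2 * s'.1)).

Definition add_section (g : R) (s s' : R * nat) : R * nat :=
  (g ^+ s'.2 * s.1 + g ^+ s.2 * s'.1, (s.2 + s'.2)%N).

Definition mul_section (c s : R * nat) : R * nat :=
  (c.1 * s.1, (c.2 + s.2)%N).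

(* S \cap D_+(g') is contained in S \cap D_+(g) iff some power of g' is a
   multiple u * g of g modulo I_S; then a / g ^ m = u ^ m * a / g' ^ (N * m). *)
Definition basic_open_le (S : closed_subscheme k) (g : R) (d : nat)
    (g' : R) (d' : nat) (u : R) (N : nat) : Prop :=
  (exists e : nat, u \is e.-homog /\ (e + d = N * d')%N) /\
  S (g' ^+ N - u * g).

Definition restrict_section (u : R) (N : nat) (s : R * nat) : R * nat :=
  (u ^+ s.2 * s.1, (N * s.2)%N).

Definition basic_open (g : R) (d : nat) : Prop :=
  [/\ g != 0, g \is d.-homog & (0 < d)%N].

(* An isomorphism of O_S-modules (J / I_S)(t) -> (J' / I_S)(t'), given on the
   base of open sets S \cap D_+(g). *)
Record is_sheaf_iso (S : closed_subscheme k) (J : R -> Prop) (t : int)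
    (J' : R -> Prop) (t' : int) (phi : R -> R * nat -> R * nat) : Prop := {
  iso_section : forall g d s, basic_open g d ->
    is_section J t d s -> is_section J' t' d (phi g s);
  iso_inj : forall g d s1 s2, basic_open g d ->
    is_section J t d s1 -> is_section J t d s2 ->
    (eq_section S g s1 s2 <-> eq_section S g (phi g s1) (phi g s2));
  iso_surj : forall g d s', basic_open g d -> is_section J' t' d s' ->
    exists s, is_section J t d s /\ eq_section S g (phi g s) s';
  iso_add : forall g d s1 s2, basic_open g d ->
    is_section J t d s1 -> is_section J t d s2 ->
    eq_section S g (phi g (add_section g s1 s2))
                   (add_section g (phi g s1) (phi g s2));
  iso_mul : forall g d c s, basic_open g d ->
    is_section (fun=> True) 0 d c -> is_section J t d s ->
    eq_section S g (phi g (mul_section c s)) (mul_section c (phi g s));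
  iso_restrict : forall g d g' d' u N s, basic_open g d -> basic_open g' d' ->
    basic_open_le S g d g' d' u N -> is_section J t d s ->
    eq_section S g' (phi g' (restrict_section u N s))
                    (restrict_section u N (phi g s))
}.

End Sections.

(* V2 \in |V1 + hH| on S: I_{V2,S} is isomorphic to I_{V1,S}(-h). *)
Definition linearly_equivalent (k : fieldType) (S V1 V2 : closed_subscheme k)
    (h : int) : Prop :=
  exists phi, is_sheaf_iso S V2 0 V1 (- h) phi.

Definition elementary_biliaison (k : fieldType) (h : int)
    (V1 V2 : closed_subscheme k) : Prop :=
  exists S : closed_subscheme k,
    [/\ plane_curve S, effective_divisor S V1, effective_divisor S V2
      & linearly_equivalent S V1 V2 h].

Definition ascending_biliaisons (k : fieldType) (V W : closed_subscheme k) : Prop :=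
  exists (r : nat) (Z : nat -> closed_subscheme k),
    [/\ same_scheme (Z 0%N) V, same_scheme (Z r) W
      & forall i, (i < r)%N -> exists h : int,
          (0 <= h)%R /\ elementary_biliaison h (Z i) (Z i.+1)].

(* n distinct points of P^2(k), given by homogeneous coordinates (the rows). *)
Record points (k : fieldType) (n : nat) := Points {
  coords :> 'M[k]_(n, 3);
  coords_neq0 : forall i, row i coords != 0;
  coords_distinct : forall i j, i != j -> ~~ (row i coords <= row j coords)%MS
}.

Definition same_points (k : fieldType) (n : nat) (A B : points k n) : Prop :=
  (forall i, exists j, (row i A == row j B)%MS) /\
  (forall j, exists i, (row i A == row j B)%MS).

Definition vanishing_ideal (k : fieldType) (n : nat) (A : points k n)
    (F : {mpoly k[3]}) : Prop :=
  forall (d : nat) (i : 'I_n), (pihomog mdeg d F).@[fun j => A i j] = 0.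

(* Restriction of F to the line spanned by the i-th row, with parameter 'X. *)
Definition line_eval (k : fieldType) (n : nat) (A : points k n) (i : 'I_n)
    (F : {mpoly k[3]}) : {poly k} :=
  mmap (@polyC k) (fun j => (A i j)%:P * 'X) F.

Lemma line_evalM (k : fieldType) (n : nat) (A : points k n) i F G :
  line_eval A i (F * G) = line_eval A i F * line_eval A i G.
Proof. by rewrite /line_eval rmorphM. Qed.

Lemma coef_line_eval (k : fieldType) (n : nat) (A : points k n) i F d :
  (line_eval A i F)`_d = (pihomog mdeg d F).@[fun j => A i j].
Proof.
have mono (m : 'X_{1..3}) : mmap1 (fun j => (A i j)%:P * 'X) m
    = (mmap1 (fun j => A i j) m)%:P * 'X^(mdeg m).
  rewrite /mmap1 mdegE -prodrXr rmorph_prod -big_split /=.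
  by apply: eq_bigr => j _; rewrite exprMn rmorphXn.
rewrite /line_eval /mmap pihomogE raddf_sum coef_sum [RHS]big_mkcond /=.
apply: eq_bigr => m _.
rewrite mono mulrA -rmorphM /= coefCM coefXn mevalZ mevalX eq_sym.
by case: eqP => _; rewrite ?mulr1 ?mulr0 // /mmap1.
Qed.

Lemma vanishing_idealP (k : fieldType) (n : nat) (A : points k n) F :
  vanishing_ideal A F <-> forall i, line_eval A i F = 0.
Proof.
split=> [H i | H d i]; last by rewrite -coef_line_eval H coef0.
by apply/polyP => d; rewrite coef_line_eval H coef0.
Qed.

Section ReducedScheme.
Variables (k : fieldType) (n : nat) (A : points k n).

Fact vanishing_ideal0 : vanishing_ideal A 0.
Proof. by move=> d i; rewrite raddf0 meval0. Qed.

Fact vanishing_idealD F G :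
  vanishing_ideal A F -> vanishing_ideal A G -> vanishing_ideal A (F + G).
Proof. by move=> HF HG d i; rewrite raddfD mevalD HF HG addr0. Qed.

Fact vanishing_idealM F G : vanishing_ideal A G -> vanishing_ideal A (F * G).
Proof.
move=> /vanishing_idealP HG; apply/vanishing_idealP => i.
by rewrite line_evalM HG mulr0.
Qed.

Fact vanishing_ideal_homog d F :
  vanishing_ideal A F -> vanishing_ideal A (pihomog mdeg d F).
Proof.
move=> HF e i; have [-> | ne] := eqVneq e d; first by rewrite pihomog_id.
by rewrite (@pihomog_ne0 _ _ _ d) ?meval0 ?pihomogP // eq_sym.
Qed.

Fact vanishing_ideal_sat F :
  (forall j : 'I_3, exists N : nat, vanishing_ideal A ('X_j ^+ N * F)) ->
  vanishing_ideal A F.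
Proof.
move=> H; apply/vanishing_idealP => i.
have /rV0Pn [j nz] := coords_neq0 A i; rewrite mxE in nz.
have [N /vanishing_idealP/(_ i)] := H j.
rewrite line_evalM => /eqP; rewrite mulf_eq0 => /orP[|/eqP //].
rewrite /line_eval rmorphXn /= mmapX mmap1U expf_eq0 mulf_eq0 polyC_eq0.
by rewrite (negPf nz) polyX_eq0 andbF.
Qed.

(* The n points with their reduced scheme structure. *)
Definition points_scheme : closed_subscheme k :=
  ClosedSubscheme vanishing_ideal0 vanishing_idealD vanishing_idealM
    vanishing_ideal_homog vanishing_ideal_sat.

End ReducedScheme.

(* Polynomials in the n * 3 coordinates of n points, homogeneous of some degree
   in the coordinates of each point. *)
Definition multihomogeneous (k : fieldType) (n : nat)
    (F : {mpoly k[n * 3]}) : Prop :=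
  exists d : 'I_n -> nat,
    forall m, m \in msupp F -> forall i,
      (\sum_(j < 3) m (mxvec_index i j))%N = d i.

Definition eval_points (k : fieldType) (n : nat) (F : {mpoly k[n * 3]})
    (A : points k n) : k :=
  F.@[fun l => mxvec A 0 l].

(* Open subsets of the family of (unordered) reduced sets of n points, which is
   the quotient by the symmetric group of the open subset of (P^2)^n formed by
   n-tuples of distinct points: U does not depend on the order of the points or
   on the choice of coordinates, and its preimage is open in the latter. *)
Definition zariski_open (k : fieldType) (n : nat) (U : points k n -> Prop) : Prop :=
  (forall A B, same_points A B -> U A -> U B) /\
  exists E : {mpoly k[n * 3]} -> Prop,
    (forall F, E F -> multihomogeneous F) /\
    forall A, U A <-> exists F, E F /\ eval_points F A != 0.

Definition general_points_have (k : fieldType) (n : nat)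
    (Y : points k n -> Prop) : Prop :=
  exists U : points k n -> Prop,
    [/\ zariski_open U, exists A, U A & forall A, U A -> Y A].

(* Main.v *)
Require Import Defs.
From mathcomp Require Import all_boot all_order all_algebra.
From HB Require Import structures.
From mathcomp Require Import zify ring.
From Stdlib Require Import Classical IndefiniteDescription.

Set Implicit Arguments.
Unset Strict Implicit.
Unset Printing Implicit Defensive.

Import GRing.Theory.
Local Open Scope ring_scope.

(** Every set of [n] points off the line [X_0 = 0] is reached from a point, so
    the open set can be taken to be the one defined by [X_0 <> 0] at each point.

    Let [d] be the least degree of a curve through the scheme [V] (at first the
    [n] points), and let [f] be such a curve.  After a projection, [f] is monic
    of degree [d] in one variable [X] over [B = k[x0, x1]], and
    [A = B[X] / (f)] is a free [B]-module of rank [d].  The ideal [I] of [V] in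
    [A] is graded and saturated, hence free over [B]: it has a homogeneous
    basis [e_j] ([graded_basis]), whose degrees [m_j] are at least [d].

    A divisor linearly equivalent to [V - h H] has the ideal [u I], where [u] is
    an invertible homogeneous fraction of degree [- h] with [u I] inside [A].
    The coefficient of [X ^ (d - 1)] defines a perfect [B]-bilinear pairing on
    [A], which is the Gorenstein property of the curve.  Hence such a fraction
    is the same thing as a [B]-linear map [lam : I -> B], and the values of
    [lam] on the basis can be chosen freely ([functional_fraction],
    [fraction_mul]).  With [N] the least of the [m_j], [lam] is taken of degree
    [- N], so that [lam (e_j)] has degree [m_j - N >= 0] and
    [h = N - (d - 1)] is positive.  For [m_j = N] the element [u e_j] has degree
    [d - 1], and its coefficient of [X ^ (d - 1)] is the constant [lam (e_j)];
    when this constant is nonzero, [u e_j] is a monic curve of degree [d - 1]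
    through the new divisor, and no element of [u I] has smaller degree.  The
    construction therefore repeats with [d - 1] in place of [d]
    ([descent_ratio], [descent]).  For [d = 1] the degree [1 - N] is used
    instead; then the new divisor lies on two distinct lines, and is a point.
    The intermediate divisors need not be reduced.

    All schemes in the construction avoid the line [x0 = 0].  This turns each
    genericity condition (invertibility of [u], nonvanishing of [lam (e_j)],
    saturation of [u I]) into linear algebra modulo [x0], where [A] becomes
    [k[X] / (f(0, 1, X))] and [u] can be prescribed.  It also shows
    that the divisors are zero-dimensional without embedded points: a form of
    large degree is divisible by [x0] modulo the ideal, so the graded pieces of
    the quotient have bounded dimension, and over an algebraically closed field
    every integral closed subscheme of the divisor is a point
    ([pure_dim0_avoids]). *)

(** * Forms in two and three variables *)

Lemma mpoly_divX (k : fieldType) n (i : 'I_n) (F : {mpoly k[n]}) :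
  (forall m, m \in msupp F -> m i != 0%N) -> exists G, F = 'X_i * G.
Proof.
move=> H; exists (\sum_(m <- msupp F) F@_m *: 'X_[m - U_(i)]).
rewrite {1}[F]mpolyE mulr_sumr big_seq [RHS]big_seq; apply: eq_bigr => m /H mi.
rewrite -scalerAr -mpolyXD addmC submK //.
by apply/mnm_lepP => j; rewrite mnm1E; case: eqP => //= <-; rewrite lt0n.
Qed.

Lemma dhomog_mulX (k : fieldType) n (i : 'I_n) (G : {mpoly k[n]}) s :
  'X_i * G \is s.-homog -> G = 0 \/ exists2 s', s = s'.+1 & G \is s'.-homog.
Proof.
move=> /dhomogP H.
have HG m : m \in msupp G -> (mdeg m).+1 = s.
  move=> mG; rewrite -(H (U_(i) + m)%MM); first by rewrite /= mdegD mdeg1.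
  by rewrite mulrC (perm_mem (msuppMX _ _)); apply/map_f.
case: (eqVneq G 0) => [-> | nz]; [by left | right].
exists (mdeg (mlead G)); first by rewrite (HG _ (mlead_supp nz)).
by apply/dhomogP => m /HG; rewrite -(HG _ (mlead_supp nz)) => -[].
Qed.

Lemma mpolyX_neq0 (k : fieldType) n (m : 'X_{1..n}) : 'X_[m] != 0 :> {mpoly k[n]}.
Proof. by rewrite -msupp_eq0 msuppX. Qed.

Section Graded.
Variable k : fieldType.
Local Notation B := {mpoly k[2]}.

(** Forms of degree [s] in the variables [x0], [x1] and ['X]. *)
Definition gr (s : nat) (p : {poly B}) : Prop :=
  forall i m, m \in msupp p`_i -> (mdeg m + i)%N = s.

(** Restriction to the line [x0 = 0], in the affine chart [x1 = 1].  A form is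
    determined up to a multiple of [x0] by its value, see [evp_eq0_div]. *)
Definition ev : B -> k := meval (fun i : 'I_2 => (i != 0)%:R).
HB.instance Definition _ := GRing.RMorphism.copy ev ev.
Definition evp : {poly B} -> {poly k} := map_poly ev.
HB.instance Definition _ := GRing.RMorphism.copy evp evp.

Lemma evpZ b p : evp (b *: p) = ev b *: evp p.
Proof. exact: map_polyZ. Qed.
Lemma evpM p q : evp (p * q) = evp p * evp q.
Proof. exact: rmorphM. Qed.
Lemma evpB p q : evp (p - q) = evp p - evp q.
Proof. exact: rmorphB. Qed.

Local Notation x0 := ('X_0 : B).
Local Notation x1 := ('X_1 : B).

Lemma ev_x0 : ev x0 = 0. Proof. by rewrite /ev mevalXU. Qed.
Lemma ev_x1 : ev x1 = 1. Proof. by rewrite /ev mevalXU. Qed.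

Lemma ev_monomial c n : ev (c%:MP * x1 ^+ n) = c.
Proof. by rewrite rmorphM rmorphXn /= ev_x1 expr1n mulr1 /ev mevalC. Qed.

Lemma gr_coef s p i : (i <= s)%N -> gr s p -> p`_i \is (s - i).-homog.
Proof. by move=> le H; apply/dhomogP => m /H <-; rewrite addnK. Qed.

Lemma gr_coef0 s p i : gr s p -> (s < i)%N -> p`_i = 0.
Proof.
move=> H lt; case: (eqVneq p`_i 0) => // nz.
by have := H _ _ (mlead_supp nz) => E; move: lt; rewrite -E ltnNge leq_addl.
Qed.

Lemma grP s (p : {poly B}) :
  (forall i, p`_i = 0 \/ exists2 r, (r + i)%N = s & p`_i \is r.-homog) -> gr s p.
Proof.
move=> H i m; case: (H i) => [-> | [r <- /dhomogP h /h <- //]].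
by rewrite msupp0.
Qed.

Lemma gr_homog s p i : gr s p -> p`_i = 0 \/ exists2 r, (r + i)%N = s & p`_i \is r.-homog.
Proof.
move=> H; case: (leqP i s) => [le | lt]; last by left; apply: gr_coef0 H lt.
by right; exists (s - i)%N; rewrite ?subnK //; apply: gr_coef.
Qed.

Lemma size_gr s p : gr s p -> (size p <= s.+1)%N.
Proof. by move=> H; apply/leq_sizeP => i; apply: gr_coef0. Qed.

Lemma gr0 s : gr s 0. Proof. by move=> i m; rewrite coef0 msupp0. Qed.

Lemma grC r b : b \is r.-homog -> gr r b%:P.
Proof.
move=> h; apply: grP => i; rewrite coefC; case: eqP => [-> | _]; last by left.
by right; exists r; rewrite ?addn0.
Qed.

Lemma gr1 : gr 0 1. Proof. exact/grC/dhomog1. Qed.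

Lemma grX : gr 1 'X.
Proof.
apply: grP => i; rewrite coefX; case: eqP => [-> | _]; last by left.
by right; exists 0%N => //; apply: dhomog1.
Qed.

Lemma grN s p : gr s p -> gr s (- p).
Proof. by move=> H i m; rewrite coefN (perm_mem (msuppN _)); apply: H. Qed.

Lemma grD s p q : gr s p -> gr s q -> gr s (p + q).
Proof.
move=> Hp Hq i m; rewrite coefD => /msuppD_le; rewrite mem_cat.
by case/orP => [/Hp | /Hq].
Qed.

Lemma grB s p q : gr s p -> gr s q -> gr s (p - q).
Proof. by move=> Hp Hq; apply: grD => //; apply: grN. Qed.

Lemma gr_sum s (I : Type) (l : seq I) (P : pred I) (F : I -> {poly B}) :
  (forall i, P i -> gr s (F i)) -> gr s (\sum_(i <- l | P i) F i).
Proof. by move=> H; apply: big_ind => //; [apply: gr0 | apply: grD]. Qed.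

Lemma grM s r p q : gr s p -> gr r q -> gr (s + r) (p * q).
Proof.
move=> Hp Hq; apply: grP => i; case: (leqP i (s + r)) => le; last first.
  left; rewrite coefM big1 // => j _.
  case: (leqP j s) => js; last by rewrite (gr_coef0 Hp js) mul0r.
  by rewrite (@gr_coef0 r q (i - j) Hq) ?mulr0 // ltn_subRL (leq_ltn_trans _ le) // leq_add2r.
right; exists (s + r - i)%N; first by rewrite subnK.
rewrite coefM; apply: rpred_sum => j _.
have ji : (j <= i)%N by rewrite -ltnS.
case: (leqP j s) => js; last by rewrite (gr_coef0 Hp js) mul0r rpred0.
case: (leqP (i - j) r) => ir; last by rewrite (gr_coef0 Hq ir) mulr0 rpred0.
have -> : (s + r - i = (s - j) + (r - (i - j)))%N.
  lia.
by apply: dhomogM; apply: gr_coef.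
Qed.

Lemma grZ r s b p : b \is r.-homog -> gr s p -> gr (r + s) (b *: p).
Proof. by move=> hb hp; rewrite -mul_polyC; apply: grM => //; apply: grC. Qed.

Lemma grZk s c p : gr s p -> gr s (c%:MP *: p).
Proof.
move=> hp; rewrite -[s]add0n; apply: grZ => //; apply/dhomogP => m /=.
by rewrite msuppC; case: eqP => //= _; rewrite inE => /eqP ->; rewrite mdeg0.
Qed.

Lemma grXn n : gr n 'X^n.
Proof.
elim: n => [|n IH]; first exact: gr1.
by rewrite exprS -add1n; apply: grM => //; apply: grX.
Qed.

Lemma x1n_homog n : x1 ^+ n \is n.-homog.
Proof. by rewrite -[n in n.-homog]mul1n; apply: dhomogMn; rewrite dhomogX /= mdeg1. Qed.

(** The only monomial of degree [r] that does not involve [x0] is a power of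
    [x1], and [ev] returns its coefficient. *)
Lemma ev_eq0_div r b : b \is r.-homog -> ev b = 0 -> exists c, b = x0 * c.
Proof.
move=> /dhomogP hb e0; apply: mpoly_divX => m mb; apply/eqP => m0.
have dm (m' : 'X_{1..2}) : mdeg m' = (m' 0%R + m' 1%R)%N.
  by rewrite mdegE big_ord_recl big_ord1; congr (_ + _)%N; congr (m' _); apply/val_inj.
have um m' : m' \in msupp b -> m' 0%R = 0%N -> m' = m.
  move=> mb' m0'; have /= := hb _ mb'; have /= <- := hb _ mb; rewrite !dm m0 m0' !add0n => E.
  apply/mnmP => -[[|[|//]] lt]; [have -> : Ordinal lt = 0%R by apply/val_inj|
    have -> : Ordinal lt = 1%R by apply/val_inj] => //.
  by rewrite m0.
move: e0; rewrite /ev mevalE (bigD1_seq m) //= [X in _ + X]big1_seq ?addr0.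
  move=> /eqP; rewrite mulf_eq0 mcoeff_eq0 mb /= prodf_seq_eq0 => /hasP[i _].
  rewrite /= expf_eq0 => /andP[]; case: (eqVneq i 0) => [-> | _] /=; first by rewrite m0.
  by rewrite oner_eq0.
move=> m' /andP[ne mb']; rewrite big_ord_recl /=.
have n0 : m' ord0 != 0%N by apply: contraNneq ne => /(um _ mb') ->.
by rewrite expr0n (negPf n0) mul0r mulr0.
Qed.

Lemma evp_eq0_div s p : gr s p -> evp p = 0 ->
  p = 0 \/ exists s' p', [/\ s = s'.+1, gr s' p', (size p' <= size p)%N & p = x0 *: p'].
Proof.
move=> hp e0.
have dv i : exists c, p`_i = x0 * c.
  case: (gr_homog i hp) => [-> | [r _ hr]]; first by exists 0; rewrite mulr0.
  by apply: ev_eq0_div hr _; rewrite -coef_map -/(evp p) e0 coef0.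
have [c Ec] := functional_choice _ dv.
pose p' := \poly_(i < size p) c i.
have Ep : p = x0 *: p'.
  apply/polyP => i; rewrite coefZ coef_poly; case: ltnP => [_|le]; first exact: Ec.
  by rewrite nth_default ?mulr0.
case: (eqVneq p 0) => [-> | nz]; [by left | right].
have hp' i : p'`_i = 0 \/ exists2 r, (r + i).+1 = s & p'`_i \is r.-homog.
  case: (gr_homog i hp); rewrite Ep coefZ.
    by move/eqP; rewrite mulf_eq0 (negPf (mpolyX_neq0 _ _)) => /eqP; left.
  case=> r <- /dhomog_mulX [-> | [r' -> h]]; first by left.
  by right; exists r'; rewrite ?addSn.
have [s' Es] : exists s', s = s'.+1.
  case: s hp hp' => [|s] hp hp'; last by exists s.
  have p'0 : p' = 0 by apply/polyP => i; rewrite coef0; case: (hp' i) => // -[].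
  by case/eqP: nz; rewrite Ep p'0 scaler0.
exists s', p'; split=> //; last exact: size_poly.
apply: grP => i; case: (hp' i) => [-> | [r E h]]; first by left.
by right; exists r => //; move: E; rewrite Es => -[].
Qed.

(** Homogenization with respect to [x1]. *)
Lemma graded_lift (a : {poly k}) n : (size a <= n.+1)%N ->
  exists p, gr n p /\ evp p = a.
Proof.
move=> sa; exists (\poly_(i < n.+1) ((a`_i)%:MP * x1 ^+ (n - i))); split.
  apply: grP => i; rewrite coef_poly; case: ltnP => le; [right | by left].
  exists (n - i)%N; first by rewrite subnK.
  by rewrite mul_mpolyC; apply: dhomogZ; apply: x1n_homog.
apply/polyP => i; rewrite coef_map coef_poly; case: ltnP => le.
  exact: ev_monomial.
by rewrite /= rmorph0 nth_default // (leq_trans sa).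
Qed.

End Graded.

(** * The residue pairing of a monic polynomial *)

Section Residue.
Variables (R : idomainType) (f : {poly R}) (d : nat).
Implicit Types p q a : {poly R}.
Hypotheses (fm : f \is monic) (sf : size f = d.+1).

(** This linear form generates the [R]-dual of [R[X] / (f)]: the pairing
    [resid (p * q)] is perfect, see [resid_nondeg] and [resid_dualX]. *)
Definition resid (p : {poly R}) : R := (p %% f)`_d.-1.

Let uf : lead_coef f \is a GRing.unit. Proof. by rewrite (monicP fm) unitr1. Qed.

Lemma residD p q : resid (p + q) = resid p + resid q.
Proof. by rewrite /resid Pdiv.IdomainUnit.modpD // coefD. Qed.

Lemma residZ b p : resid (b *: p) = b * resid p.
Proof. by rewrite /resid Pdiv.IdomainUnit.modpZl // coefZ. Qed.

Lemma resid_sum (I : Type) (l : seq I) (P : pred I) (F : I -> {poly R}) :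
  resid (\sum_(i <- l | P i) F i) = \sum_(i <- l | P i) resid (F i).
Proof.
by apply: (big_morph resid residD); rewrite /resid mod0p coef0.
Qed.

Lemma resid_dvd p : f %| p -> resid p = 0.
Proof. by rewrite /resid => /modp_eq0P ->; rewrite coef0. Qed.

Lemma resid_eq p q : f %| p - q -> resid p = resid q.
Proof. by move=> /resid_dvd h; rewrite -[p](subrK q) residD h add0r. Qed.

Lemma resid_small p : (size p <= d)%N -> resid p = p`_d.-1.
Proof. by move=> h; rewrite /resid modp_small // sf. Qed.

Lemma size_modf p : (size (p %% f)%R <= d)%N.
Proof. by rewrite -ltnS -sf ltn_modp monic_neq0. Qed.

Lemma dvd_submod p : f %| p - p %% f.
Proof. by rewrite {1}(Pdiv.IdomainMonic.divp_eq fm p) addrK dvdp_mull. Qed.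

(** If the remainder of [a] had degree [n < d], then multiplying it by
    ['X^(d - 1 - n)] would bring its leading coefficient in degree [d - 1]. *)
Lemma resid_nondeg a : (0 < d)%N ->
  (forall i, (i < d)%N -> resid ('X^i * a) = 0) -> f %| a.
Proof.
move=> d0 H; rewrite /dvdp; apply: contraT => nz; set r := a %% f in nz.
have sr : (0 < size r <= d)%N by rewrite size_poly_gt0 nz size_modf.
have /(H _) : (d - size r < d)%N by case/andP: sr => sr0 _; lia.
have -> : resid ('X^(d - size r) * a) = resid ('X^(d - size r) * r).
  by apply: resid_eq; rewrite -mulrBr dvdp_mull // dvd_submod.
rewrite mulrC resid_small; last by rewrite size_mulXn ?subnK //; case/andP: sr.
rewrite coefMXn; case: ltnP => [|_]; first by case/andP: sr; lia.
have -> : (d.-1 - (d - size r) = (size r).-1)%N by case/andP: sr; lia.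
by move/eqP; rewrite -lead_coefE lead_coef_eq0 (negPf nz).
Qed.

(** The quotient of [f] by ['X^i.+1].  These quotients are dual to the powers
    of ['X] for the pairing [resid (p * q)], see [resid_dualX]. *)
Definition dualX i : {poly R} := drop_poly i.+1 f.

Lemma size_dualX i : (size (dualX i) <= d)%N.
Proof. by rewrite size_drop_poly sf subSS leq_subr. Qed.

Lemma resid_dualX i j : (i < d)%N -> (j < d)%N ->
  resid ('X^j * dualX i) = (i == j)%:R.
Proof.
move=> id jd; rewrite mulrC.
case: (leqP j i) => ji.
  have sz : (size (dualX i * 'X^j)%R <= d)%N.
    rewrite (leq_trans (size_polyMleq _ _)) // size_drop_poly sf size_polyXn; lia.
  rewrite resid_small // coefMXn coef_drop_poly; case: ltnP => [|_]; first by lia.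
  have -> : (d.-1 - j + i.+1 = d + (i - j))%N by lia.
  have := monicP fm; rewrite lead_coefE sf /= => f1.
  have [/eqP | ne] := posnP (i - j).
    by rewrite subn_eq0 => ij; rewrite (_ : i = j) ?subnn ?addn0 ?eqxx //; lia.
  by rewrite nth_default ?sf; [case: eqP => // ?; lia | lia].
have -> : (i == j) = false by lia.
rewrite (@resid_eq _ (- (take_poly i.+1 f * 'X^(j - i.+1)))).
  rewrite -scaleN1r residZ resid_small.
    rewrite coefMXn coef_take_poly; case: ltnP => _; rewrite ?mulr0 //.
    by case: ltnP => [|_]; rewrite ?mulr0 //; lia.
  rewrite (leq_trans (size_polyMleq _ _)) // size_polyXn.
  by have := size_take_poly i.+1 f; lia.
rewrite opprK addrC -{2}[j](@subnKC i.+1) // exprD mulrA -mulrDl.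
by rewrite poly_take_drop dvdp_mulr.
Qed.

Lemma resid_dual_sum (w : 'I_d -> R) p : (size p <= d)%N ->
  resid (p * \sum_(i < d) w i *: dualX i) = \sum_(i < d) p`_i * w i.
Proof.
move=> sp; have -> : p = \sum_(j < d) p`_j *: 'X^j.
  rewrite -poly_def; apply/polyP => i; rewrite coef_poly; case: ltnP => //.
  by move=> /(leq_trans sp) /leq_sizeP ->.
rewrite mulr_suml resid_sum.
rewrite [RHS](eq_bigr (fun i : 'I_d => p`_i * w i)); last first.
  move=> i _; congr (_ * _); rewrite -poly_def coef_poly ltn_ord //.
apply: eq_bigr => j _; rewrite -scalerAl residZ mulr_sumr resid_sum.
rewrite (bigD1 j) //= big1 ?addr0 => [|i ne]; rewrite -scalerAr residZ resid_dualX //.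
  by rewrite eqxx mulr1.
by rewrite (negPf (_ : i != j :> nat)) ?mulr0.
Qed.

Lemma resid_dual_expand a : (0 < d)%N ->
  f %| a - \sum_(i < d) resid ('X^i * a) *: dualX i.
Proof.
move=> d0; apply: resid_nondeg => // j jd; rewrite mulrBr -scaleN1r residD residZ.
rewrite resid_dual_sum ?size_polyXn // (bigD1 (Ordinal jd)) //= big1 ?addr0.
  by rewrite coefXn eqxx mul1r mulN1r subrr.
by move=> i ne; rewrite coefXn (negPf (_ : i != j :> nat)) ?mul0r.
Qed.

End Residue.

Lemma dualX_map (R S : idomainType) (g : {rmorphism R -> S}) (f : {poly R}) i :
  map_poly g (dualX f i) = dualX (map_poly g f) i.
Proof. by apply/polyP => j; rewrite coef_map !coef_drop_poly coef_map. Qed.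

Lemma nat_minimal (P : nat -> Prop) : (exists n, P n) ->
  exists2 n, P n & forall m, P m -> (n <= m)%N.
Proof.
case=> n; elim/ltn_ind: n => n IH Pn.
have [[m [lt Pm]] | H] := classic (exists m, (m < n)%N /\ P m); first exact: IH Pm.
by exists n => // m Pm; rewrite leqNgt; apply/negP => lt; apply: H; exists m.
Qed.

Lemma gr_modp (k : fieldType) (f : {poly {mpoly k[2]}}) d s p :
  f \is monic -> gr d f -> size f = d.+1 -> gr s p -> gr s (p %% f).
Proof.
move=> fm gf sf; have [n] := ubnP (size p); elim: n p => // n IH p sp gp.
case: (leqP (size p) d) => le; first by rewrite modp_small // sf.
have uf : lead_coef f \is a GRing.unit by rewrite (monicP fm) unitr1.
pose q := lead_coef p *: 'X^(size p - d.+1).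
have nz : p != 0 by rewrite -size_poly_gt0; lia.
have sl : ((size p).-1 <= s)%N by have := size_gr gp; lia.
have gq : gr s (q * f).
  have -> : s = ((s - (size p).-1) + (size p - d.+1) + d)%N by lia.
  by apply: grM => //; apply: grZ; [apply: gr_coef | apply: grXn].
have E : p %% f = (p - q * f) %% f.
  by rewrite Pdiv.IdomainUnit.modpD // -mulNr modp_mull addr0.
rewrite E; apply: IH; last exact: grB.
have lt_sz : (size (p - q * f)%R < size p)%N; last by exact: leq_trans lt_sz _.
rewrite -[size p]prednK ?ltnS; last by lia.
apply/leq_sizeP => i hi; rewrite coefB -scalerAl coefZ coefXnM.
case: ltnP => [|_]; first by lia.
move: hi; rewrite leq_eqVlt => /predU1P[<- | hi].
  have -> : ((size p).-1 - (size p - d.+1) = d)%N by lia.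
  by have := monicP fm; rewrite !lead_coefE sf /= => ->; rewrite mulr1 subrr.
have {}hi : (size p <= i)%N.
  by move: hi; rewrite prednK; last lia.
by rewrite !nth_default ?mulr0 ?subrr // ?sf; lia.
Qed.

(** * Graded freeness of the ideal of a divisor *)

Section Core.
Variable k : fieldType.
Local Notation B := {mpoly k[2]}.
Local Notation x0 := ('X_0 : B).
Local Notation x1 := ('X_1 : B).
Variables (I : {poly B} -> Prop) (f dlt : {poly B}) (d t : nat).
Hypotheses (ID : forall p q : {poly B}, I p -> I q -> I (p + q))
  (IM : forall p q : {poly B}, I q -> I (p * q))
  (Isat : forall p : {poly B}, I (x0 *: p) -> I p).
Hypotheses (fm : f \is monic) (sf : size f = d.+1) (gf : gr d f) (If : I f).
Hypotheses (d_gt0 : (0 < d)%N).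
Hypotheses (Idlt : I dlt) (gdlt : gr t dlt) (evdlt : evp dlt = 1).

Let F := evp f.

Lemma evp_monic : F \is monic. Proof. by rewrite monic_map. Qed.
Lemma size_evp : size F = d.+1.
Proof. by rewrite size_map_poly_id0 // (monicP fm) rmorph1 oner_eq0. Qed.

Lemma evp_modp p : evp (p %% f) = evp p %% F.
Proof.
have uF : lead_coef F \is a GRing.unit by rewrite (monicP evp_monic) unitr1.
rewrite {2}(Pdiv.IdomainMonic.divp_eq fm p) rmorphD rmorphM /= -/F.
rewrite Pdiv.IdomainUnit.modp_addl_mul_small // size_evp ltnS.
by rewrite (leq_trans (size_poly _ _)) // (size_modf fm sf).
Qed.

Lemma ideal_opp p : I p -> I (- p). Proof. by rewrite -mulN1r; apply: IM. Qed.
Lemma ideal_sub p q : I p -> I q -> I (p - q).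
Proof. by move=> hp hq; apply: ID => //; apply: ideal_opp. Qed.
Lemma ideal_scale b p : I p -> I (b *: p). Proof. by rewrite -mul_polyC; apply: IM. Qed.
Lemma ideal_zero : I 0. Proof. by rewrite -(mul0r f); apply: IM. Qed.
Lemma ideal_dvd p : f %| p -> I p.
Proof. by move=> /(Pdiv.IdomainMonic.dvdpP fm)[q ->]; apply: IM. Qed.
Lemma ideal_modp p : I p -> I (p %% f).
Proof.
move=> Ip; rewrite -[p %% f](subKr p); apply: ideal_sub => //.
by apply: ideal_dvd; apply: dvd_submod.
Qed.
Lemma ideal_sum (J : Type) (l : seq J) (P : pred J) (G : J -> {poly B}) :
  (forall j, P j -> I (G j)) -> I (\sum_(j <- l | P j) G j).
Proof. by move=> H; apply: big_ind => //; apply: ideal_zero. Qed.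

Definition evmx (e : 'I_d -> {poly B}) : 'M[k]_d := \matrix_(i, j) (evp (e i))`_j.

(** The determinant condition says that the restrictions of the [e j] to the
    line [x0 = 0] form a basis of [k[X] / (F)]. *)
Definition graded_family (e : 'I_d -> {poly B}) (m : 'I_d -> nat) : Prop :=
  (forall j, [/\ I (e j), gr (m j) (e j) & (size (e j) <= d)%N]) /\ \det (evmx e) != 0.

Lemma graded_family_exists : exists e m, graded_family e m.
Proof.
exists (fun j => (dlt * 'X^j) %% f), (fun j => (t + j)%N); split=> [j|].
  split; [by apply: ideal_modp; rewrite mulrC; apply: IM | | exact: (size_modf fm sf)].
  by apply: (gr_modp fm gf sf); apply: grM => //; apply: grXn.
rewrite (_ : evmx _ = 1%:M) ?det1 ?oner_eq0 //; apply/matrixP => i j; rewrite !mxE.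
rewrite evp_modp rmorphM /= evdlt mul1r [evp _]map_polyXn modp_small ?coefXn 1?eq_sym //.
by rewrite size_evp size_polyXn ltnS.
Qed.

(** If the restriction of [v] had a nonzero coordinate along [e j], then [v]
    could replace [e j], which would lower the sum of the degrees.  By Cramer's
    rule this coordinate is the entry of the product with the adjugate, up to
    the determinant. *)
Lemma graded_family_exchange e m s v j : graded_family e m ->
  (forall e' m', graded_family e' m' -> (\sum_i m i <= \sum_i m' i)%N) ->
  I v -> gr s v -> (size v <= d)%N -> (s < m j)%N ->
  ((\row_i (evp v)`_i) *m \adj (evmx e)) 0 j = 0.
Proof.
move=> [he de] mn Iv gv sv lt; apply/eqP; apply: contraTT lt => nz; rewrite -leqNgt.
pose e' i := if i == j then v else e i.
pose m' i := if i == j then s else m i.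
suff /mn : graded_family e' m'.
  rewrite (bigD1 j) // [X in (_ <= X)%N -> _](bigD1 j) //= /m' eqxx.
  rewrite [X in (_ <= _ + X)%N -> _](eq_bigr m) ?leq_add2r // => i /negPf -> //.
split=> [i|]; first by rewrite /e' /m'; case: eqP.
apply: contraNneq nz => E; apply/eqP; rewrite -[RHS]E (expand_det_row _ j) mxE.
apply: eq_bigr => l _; rewrite !mxE /e' eqxx; congr (_ * _).
rewrite /cofactor; congr (_ * \det _); apply/matrixP => a b; rewrite !mxE.
by rewrite eq_sym (negPf (neq_lift _ _)).
Qed.

Lemma evp_comb (e : 'I_d -> {poly B}) (v : {poly B}) : \det (evmx e) != 0 ->
  (forall j, (size (e j) <= d)%N) -> (size v <= d)%N ->
  evp v = \sum_j (((\row_i (evp v)`_i) *m \adj (evmx e)) 0 j / \det (evmx e)) *: evp (e j).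
Proof.
move=> de se sv; set r := \row_i _.
have E : r = (\det (evmx e))^-1 *: (r *m \adj (evmx e) *m evmx e).
  by rewrite -mulmxA mul_adj_mx mul_mx_scalar scalerA mulVf // scale1r.
have sz (p : {poly B}) : (size p <= d)%N -> (size (evp p) <= d)%N.
  by apply: leq_trans; apply: size_poly.
apply/polyP => i; case: (ltnP i d) => id; last first.
  rewrite nth_default ?(leq_trans (sz _ sv)) // coef_sum big1 // => j _.
  by rewrite coefZ nth_default ?mulr0 // (leq_trans (sz _ (se j))).
have /matrixP/(_ 0 (Ordinal id)) := E; rewrite !mxE /= => ->.
rewrite coef_sum mulr_sumr; apply: eq_bigr => j _.
by rewrite coefZ !mxE mulrA [_^-1 * _]mulrC.
Qed.

(** A family with the least sum of degrees generates [I] modulo [f]: by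
    [graded_family_exchange], a form [v] agrees on the line [x0 = 0] with a
    homogeneous combination of the [e j]; the difference is [x0] times a form
    of [I] of smaller degree. *)
Lemma graded_basis : exists e m, graded_family e m /\
  forall s v, I v -> gr s v -> (size v <= d)%N ->
  exists2 b : 'I_d -> B, v = \sum_j b j *: e j &
    forall j, b j = 0 \/ exists2 r, (r + m j)%N = s & b j \is r.-homog.
Proof.
have [|n [e [m [gem En]]] mn] := @nat_minimal
  (fun n => exists e m, graded_family e m /\ n = (\sum_i m i)%N).
  by have [e [m H]] := graded_family_exists; exists (\sum_i m i)%N, e, m.
have {n En} mn e' m' : graded_family e' m' -> (\sum_i m i <= \sum_i m' i)%N.
  by move=> H; rewrite -En; apply: mn; exists e', m'.
exists e, m; split=> // s; elim/ltn_ind: s => s IH v Iv gv sv.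
have [he de] := gem.
pose c j := ((\row_i (evp v)`_i) *m \adj (evmx e)) 0 j / \det (evmx e).
have Ev : evp v = \sum_j c j *: evp (e j) by apply: evp_comb => // j; case: (he j).
have c0 j : (s < m j)%N -> c j = 0.
  by move=> lt; rewrite /c (graded_family_exchange gem mn Iv gv sv lt) mul0r.
pose a j : B := (c j)%:MP * x1 ^+ (s - m j).
have ha j : a j = 0 \/ exists2 r, (r + m j)%N = s & a j \is r.-homog.
  case: (leqP (m j) s) => le; last by left; rewrite /a c0 // mpolyC0 mul0r.
  right; exists (s - m j)%N; first by rewrite subnK.
  by rewrite /a mul_mpolyC; apply: dhomogZ; apply: x1n_homog.
have gw : gr s (v - \sum_j a j *: e j).
  apply: grB => //; apply: gr_sum => j _; case: (ha j) => [-> | [r <- h]].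
    by rewrite scale0r; apply: gr0.
  by apply: grZ => //; case: (he j).
have [|w0 | [s' [w [Es gw' sw Ew]]]] := evp_eq0_div gw.
- rewrite rmorphB rmorph_sum /= Ev -sumrB big1 // => j _.
  by rewrite evpZ ev_monomial subrr.
- by exists a => //; apply/eqP; rewrite -subr_eq0 w0.
have Iw : I w.
  apply: Isat; rewrite -Ew; apply: ideal_sub => //; apply: ideal_sum => j _; apply: ideal_scale.
  by case: (he j).
have sw' : (size w <= d)%N.
  rewrite (leq_trans sw) // (leq_trans (size_polyD _ _)) // geq_max sv size_polyN.
  apply: (leq_trans (size_sum _ _ _)); apply/bigmax_leqP => j _.
  by rewrite (leq_trans (size_scale_leq _ _)) //; case: (he j).
have [|b Eb hb] := IH s' _ w Iw gw' sw'; first by rewrite Es.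
exists (fun j => a j + x0 * b j).
  rewrite (eq_bigr (fun j => a j *: e j + x0 *: (b j *: e j))); last first.
    by move=> j _; rewrite scalerDl scalerA.
  by rewrite big_split /= -scaler_sumr -Eb -Ew addrC subrK.
move=> j; case: (leqP (m j) s) => le; last first.
  left; case: (ha j) => [-> | [r E]]; last by lia.
  by case: (hb j) => [-> | [r' E']]; rewrite ?mulr0 ?addr0 //; lia.
right; exists (s - m j)%N; first by rewrite subnK.
apply: rpredD.
  case: (ha j) => [-> | [r <- h]]; first exact: rpred0.
  by rewrite addnK.
case: (hb j) => [-> | [r' E' h]]; first by rewrite mulr0 rpred0.
rewrite (_ : (s - m j = 1 + r')%N); last by lia.
by apply: dhomogM => //; rewrite dhomogX /= mdeg1.
Qed.

End Core.

(** * Fractions carrying the ideal into the coordinate ring *)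

Lemma gr_dualX (k : fieldType) (f : {poly {mpoly k[2]}}) d i :
  gr d f -> (i < d)%N -> gr (d - i.+1) (dualX f i).
Proof.
move=> gf id; apply: grP => j; rewrite coef_drop_poly.
case: (gr_homog (j + i.+1) gf) => [-> | [r E h]]; [by left | right].
by exists r => //; lia.
Qed.

(** If [a] is not a root of [F], then the powers of ['X - a] are coprime to [F],
    and they span all polynomials; so one of them pairs nontrivially with [w]. *)
Lemma coprime_resid_neq0 (k : closedFieldType) (F w : {poly k}) d :
  F \is monic -> size F = d.+1 -> (0 < d)%N -> ~~ (F %| w) ->
  exists u, coprimep F u /\ resid F d (w * u) != 0.
Proof.
move=> Fm sF d0 nd.
have /closed_nonrootP [a ra] : F != 0 by apply: monic_neq0.
have cop i : coprimep F (('X - a%:P) ^+ i).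
  by rewrite coprimep_expr // coprimep_XsubC.
apply: NNPP => H; case/negP: nd.
have z i : resid F d (w * ('X - a%:P) ^+ i) = 0.
  apply/eqP; apply: contraT => nz; exfalso; apply: H.
  by exists (('X - a%:P) ^+ i).
apply: (resid_nondeg Fm sF) => // j _.
rewrite -['X](subrK a%:P) exprDn mulr_suml resid_sum // big1 // => i _.
rewrite -mulrnAr -rmorphXn -rmorphMn /= mulrAC mulrC mul_polyC [_ * w]mulrC.
by rewrite residZ // z mulr0.
Qed.

Section Twist.
Variable k : closedFieldType.
Local Notation B := {mpoly k[2]}.
Local Notation x0 := ('X_0 : B).
Local Notation x1 := ('X_1 : B).
Variables (I : {poly B} -> Prop) (f dlt : {poly B}) (d t : nat).
Hypotheses (ID : forall p q : {poly B}, I p -> I q -> I (p + q))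
  (IM : forall p q : {poly B}, I q -> I (p * q))
  (Isat : forall p : {poly B}, I (x0 *: p) -> I p).
Hypotheses (fm : f \is monic) (sf : size f = d.+1) (gf : gr d f) (If : I f).
Hypotheses (d_gt0 : (0 < d)%N).
Hypotheses (Idlt : I dlt) (gdlt : gr t dlt) (evdlt : evp dlt = 1).
Hypothesis Imin : forall s v, I v -> gr s v -> v != 0 -> (d <= s)%N.

Let F := evp f.
Let Fm' : F \is monic := evp_monic fm.
Let sF' : size F = d.+1 := size_evp fm sf.

(** The [B]-linear functional with the values [l j] on the [e j] is the pairing
    with the fraction [G / D0].  Here [D0] is the determinant of the [e j], and
    the pairings of [G] with the powers of ['X] solve the linear system by
    Cramer's rule.  The second hypothesis says that, on the line [x0 = 0], the
    functional is the pairing with [u]; then the fraction restricts to [u]. *)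
Lemma functional_fraction (e : 'I_d -> {poly B}) (l : 'I_d -> B) (u : {poly k}) :
  (forall j, (size (e j) <= d)%N) ->
  (forall j, ev (l j) = resid F d (evp (e j) * u)) ->
  \det (evmx e) != 0 ->
  exists D0 G, [/\ ev D0 != 0, forall j, resid f d (e j * G) = D0 * l j
    & F %| evp G - ev D0 *: u].
Proof.
move=> se el de.
pose M : 'M[B]_d := \matrix_(i, j) (e i)`_j.
have evM : map_mx (@ev k) M = evmx e.
  by apply/matrixP => i j; rewrite !mxE coef_map.
pose w : 'cV[B]_d := \adj M *m \col_j l j.
exists (\det M), (\sum_(i < d) w i 0 *: dualX f i).
have evdet : ev (\det M) = \det (evmx e) by rewrite -evM det_map_mx.
split; first by rewrite evdet.
  move=> j; rewrite (resid_dual_sum fm sf) //.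
  have := mul_mx_adj M => /(congr1 (fun A => (A *m \col_j l j) j 0)).
  rewrite -mulmxA mul_scalar_mx !mxE => <-; apply: eq_bigr => i _; by rewrite !mxE.
pose tau : 'cV[k]_d := \col_i resid F d ('X^i * u).
have ew : map_mx (@ev k) w = \det (evmx e) *: tau.
  rewrite map_mxM map_mx_adj evM (_ : map_mx _ _ = evmx e *m tau).
    by rewrite mulmxA mul_adj_mx mul_scalar_mx.
  apply/matrixP => j i; rewrite !mxE -[LHS]/(ev (l j)) el.
  have -> : resid F d (evp (e j) * u)
      = resid F d (evp (e j) * \sum_(i < d) resid F d ('X^i * u) *: dualX F i).
    by apply: resid_eq => //; rewrite -mulrBr dvdp_mull // resid_dual_expand.
  rewrite (resid_dual_sum Fm' sF') ?(leq_trans (size_poly _ _)) //.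
  by apply: eq_bigr => l' _; rewrite !mxE.
rewrite rmorph_sum /= evdet.
rewrite (eq_bigr (fun i : 'I_d => \det (evmx e) *: (tau i 0 *: dualX F i))); last first.
  move=> i _; rewrite evpZ (dualX_map _ f i : evp _ = _) scalerA; congr (_ *: _).
  by have /matrixP/(_ i 0) := ew; rewrite !mxE.
rewrite -scaler_sumr -scalerBr dvdpZr // -dvdpNr opprB.
rewrite (eq_bigr (fun i : 'I_d => resid F d ('X^i * u) *: dualX F i)).
  exact: resid_dual_expand.
by move=> i _; rewrite mxE.
Qed.

Definition graded_spans (e : 'I_d -> {poly B}) (m : 'I_d -> nat) : Prop :=
  forall s v, I v -> gr s v -> (size v <= d)%N ->
  exists2 b : 'I_d -> B, v = \sum_j b j *: e j &
    forall j, b j = 0 \/ exists2 r, (r + m j)%N = s & b j \is r.-homog.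

(** The fraction [G / D0] carries [I] into the coordinate ring: the pairings of
    [v * G] with the powers of ['X] are values of the functional on [I], times
    [D0], so they are divisible by [D0]; the quotients are the coordinates of
    [y] on the dual basis. *)
Lemma fraction_mul e m h (l : 'I_d -> B) D0 G : graded_spans e m ->
  (forall j, (h + d.-1 <= m j)%N) ->
  (forall j, l j \is (m j - (h + d.-1)).-homog) ->
  (forall j, resid f d (e j * G) = D0 * l j) ->
  forall s v, I v -> gr s v ->
  exists y, [/\ f %| D0 *: y - v * G, (size y <= d)%N
    & y = 0 \/ exists2 r, (r + h)%N = s & gr r y].
Proof.
move=> span hm hl hG s v Iv gv.
have ex (i : nat) : exists la : B, resid f d ('X^i * v * G) = D0 * la /\
    (la = 0 \/ exists2 r, (r + (h + d.-1))%N = (s + i)%N & la \is r.-homog).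
  have [||| b Eb hb] := span (i + s)%N (('X^i * v) %% f).
  - by apply: (ideal_modp ID IM fm If); apply: IM.
  - by apply: (gr_modp fm gf sf); apply: grM => //; apply: grXn.
  - exact: (size_modf fm sf).
  exists (\sum_j b j * l j); split.
    rewrite (@resid_eq _ f d fm _ (('X^i * v) %% f * G)); last first.
      by rewrite -mulrBl dvdp_mulr // dvd_submod.
    rewrite Eb mulr_suml resid_sum // mulr_sumr; apply: eq_bigr => j _.
    by rewrite -scalerAl residZ // hG mulrCA.
  case: (leqP (h + d.-1) (s + i)) => le.
    right; exists (s + i - (h + d.-1))%N; first by rewrite subnK.
    apply: rpred_sum => j _; case: (hb j) => [-> | [r Er hr]].
      by rewrite mul0r rpred0.
    have -> : (s + i - (h + d.-1) = r + (m j - (h + d.-1)))%N.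
      by have := hm j; lia.
    exact: dhomogM.
  left; rewrite big1 // => j _; case: (hb j) => [-> | [r Er hr]].
    by rewrite mul0r.
  by have := hm j; lia.
have [la Hla] := functional_choice _ ex.
exists (\sum_(i < d) la i *: dualX f i); split.
- apply: (resid_nondeg fm sf) => // j jd.
  rewrite mulrBr -scaleN1r residD // residZ // -scalerAr residZ //.
  rewrite (resid_dual_sum fm sf) ?size_polyXn // (bigD1 (Ordinal jd)) //= big1.
    by rewrite addr0 coefXn eqxx mul1r mulrA (proj1 (Hla j)) mulN1r subrr.
  by move=> i ne; rewrite coefXn (negPf (_ : i != j :> nat)) ?mul0r.
- apply: (leq_trans (size_sum _ _ _)); apply/bigmax_leqP => i _.
  by rewrite (leq_trans (size_scale_leq _ _)) // (size_dualX sf).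
case: (leqP h s) => le; [right; exists (s - h)%N; rewrite ?subnK // | left].
  apply: gr_sum => i _; case: (proj2 (Hla i)) => [-> | [r Er hr]].
    by rewrite scale0r; apply: gr0.
  have -> : (s - h = r + (d - i.+1))%N by have := ltn_ord i; lia.
  by apply: grZ => //; apply: gr_dualX.
rewrite big1 // => i _; case: (proj2 (Hla i)) => [-> | [r Er hr]].
  by rewrite scale0r.
by have := ltn_ord i; lia.
Qed.

Lemma dvdF_evp p : f %| p -> F %| evp p.
Proof.
by move/(Pdiv.IdomainMonic.dvdpP fm) => [q ->]; rewrite evpM dvdp_mull.
Qed.

(** If [p] is invertible modulo [f] and [x0], then the remainder of [a] modulo
    [f] vanishes for [x0 = 0], hence is divisible by [x0], and one can descend
    on the degree of [a]. *)
Lemma graded_regular s r p a : gr r p -> coprimep F (evp p) -> gr s a ->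
  f %| p * a -> f %| a.
Proof.
move=> gp cop; elim: s a => [|s IH] a ga dv.
all: set b := a %% f; have gb : gr _ b := gr_modp fm gf sf ga.
all: have dvb : f %| p * b by
  rewrite -[b](subKr a) mulrBr; apply: dvdp_sub => //; rewrite dvdp_mull // dvd_submod.
all: have e0 : evp b = 0 by
  have := dvdF_evp dvb; rewrite evpM Gauss_dvdpr // /dvdp modp_small;
  [move/eqP | rewrite sF' ltnS (leq_trans (size_poly _ _)) // (size_modf fm sf)].
all: case: (evp_eq0_div gb e0) => [b0 | [s' [c [Es gc sc Ec]]]];
  first by rewrite /dvdp -/b b0.
  by [].
have {Es} Es : s' = s by case: Es.
have : f %| c.
  apply: IH; first by rewrite -Es.
  by move: dvb; rewrite Ec -scalerAr dvdpZr // mpolyX_neq0.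
rewrite /dvdp modp_small => [/eqP c0|]; first by rewrite -/b Ec c0 scaler0.
by rewrite sf ltnS (leq_trans sc) // (size_modf fm sf).
Qed.

(** The ratio [gm / dlt] carries [I] into the coordinate ring of the curve [f]
    and lowers degrees by [h].  The numerator [gm] is the image of the element
    [dlt] of [I] under the fraction of [functional_fraction].  The second
    conclusion exhibits an element of least degree in the image, and the third
    one says that nothing of [I] is sent to a smaller degree.  The shift
    [kap] serves for lines, where the value [0] gives the unit ideal as image,
    and the value [1] the ideal of a point. *)
Theorem descent_ratio kap : (kap <= 1)%N ->
  exists h r gm, [/\ (r + h)%N = t, gr r gm, coprimep F (evp gm)
    & [/\
      forall s v, I v -> gr s v -> exists y, f %| gm * v - dlt * y /\
        (y = 0 \/ exists2 r', (r' + h)%N = s & gr r' y),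
      exists s v y, [/\ I v, gr s v, f %| gm * v - dlt * y,
        gr (d.-1 + kap) y & (size y <= d)%N /\
        exists2 c, c != 0 & y`_d.-1 = c%:MP * x1 ^+ kap]
      & forall s v, I v -> gr s v -> (s < d.-1 + kap + h)%N -> f %| v]].
Proof.
move=> kap1.
have [e [m [[he de] span]]] := graded_basis ID IM Isat fm sf gf If d_gt0 Idlt gdlt evdlt.
have se j : (size (e j) <= d)%N by case: (he j).
have enz j : ~~ (F %| evp (e j)).
  apply/negP; rewrite /dvdp modp_small => [/eqP z|]; last first.
    by rewrite sF' ltnS (leq_trans (size_poly _ _)).
  case/eqP: de; rewrite (expand_det_row _ j) big1 // => i _.
  by rewrite mxE z coef0 mul0r.
have md j : (d <= m j)%N.
  have [Ij gj _] := he j; apply: Imin Ij gj _.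
  by apply: contraNneq (enz j) => ->; rewrite rmorph0 dvdp0.
have [j0 mj0] : exists j0, forall j, (m j0 <= m j)%N.
  by exists [arg min_(j < Ordinal d_gt0) m j] => j; case: arg_minnP => // i _; apply.
have [h hN] : exists h, (h + d.-1 = m j0 - kap)%N.
  by exists (m j0 - kap - d.-1)%N; have := md j0; lia.
have hkap : (m j0 - (h + d.-1) = kap)%N by clear - hN md kap1 d_gt0; have := md j0; lia.
have hdeg r' : (r' + h)%N = m j0 -> (d.-1 + kap)%N = r'.
  by clear - hN md kap1 d_gt0; have := md j0; lia.
have hlow j r' s : (r' + m j)%N = s -> (s < d.-1 + kap + h)%N -> False.
  by clear - hN md mj0 kap1 d_gt0; have := mj0 j; have := md j0; lia.
have hm j : (h + d.-1 <= m j)%N by clear - hN mj0; have := mj0 j; lia.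
(* On [x0 = 0] the fraction is [u], coprime to [f] so that it is invertible,
   and chosen such that the functional does not vanish at [e j0]. *)
have [u [cop uj0]] := coprime_resid_neq0 Fm' sF' d_gt0 (enz j0).
pose c j := resid F d (evp (e j) * u).
pose l j : B := (c j)%:MP * x1 ^+ (m j - (h + d.-1)).
have el j : ev (l j) = c j by apply: ev_monomial.
have hl j : l j \is (m j - (h + d.-1)).-homog.
  by rewrite /l mul_mpolyC; apply: dhomogZ; apply: x1n_homog.
have [D0 [G [D0nz hG evG]]] := functional_fraction se el de.
have psi := fraction_mul span hm hl hG.
have D0n : D0 != 0 by apply: contraNneq D0nz => ->; rewrite rmorph0.
have [gm [Egm _ ggm]] := psi _ _ Idlt gdlt.
have evgm : F %| evp gm - u.
  rewrite -(dvdpZr _ _ D0nz) scalerBr.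
  have evE : evp (D0 *: gm - dlt * G) = ev D0 *: evp gm - evp G.
    by rewrite evpB evpM evdlt mul1r evpZ.
  have := dvdp_add (dvdF_evp Egm) evG.
  by rewrite evE addrA subrK.
have copg : coprimep F (evp gm).
  rewrite -[evp gm](subrK u); have [q ->] := Pdiv.IdomainMonic.dvdpP Fm' _ evgm.
  by rewrite coprimep_addl_mul.
have [r Er gr_gm] : exists2 r, (r + h)%N = t & gr r gm.
  case: ggm => // z; move: copg; rewrite z rmorph0 coprimep0 => /eqp_size.
  by rewrite sF' size_poly1 => -[d0]; move: d_gt0; rewrite d0.
have rel v y : f %| D0 *: y - v * G -> f %| gm * v - dlt * y.
  move=> Ey; rewrite -(dvdpZr _ _ D0n).
  have -> : D0 *: (gm * v - dlt * y)
      = v * (D0 *: gm - dlt * G) - dlt * (D0 *: y - v * G).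
    rewrite scalerBr -!mul_polyC !mulrBr.
    by rewrite opprB addrA [v * (dlt * G)]mulrCA subrK [gm * v]mulrC !(mulrCA D0%:P).
  by apply: dvdp_sub; rewrite dvdp_mull.
exists h, r, gm; split=> //; split.
- move=> s v Iv gv; have [y [Ey _ gy]] := psi s v Iv gv.
  by exists y; split=> //; apply: rel.
- have [Ij gj sj] := he j0; have [y [Ey sy gy]] := psi _ _ Ij gj.
  have Ty : y`_d.-1 = (c j0)%:MP * x1 ^+ kap.
    apply: (mulfI D0n); rewrite -(resid_small sf sy) -(residZ d fm).
    by rewrite (@resid_eq _ f d fm _ (e j0 * G)) // hG /l hkap.
  exists (m j0), (e j0), y; split=> //; first exact: rel.
    case: gy => [-> | [r' Er' gy]]; first exact: gr0.
    by rewrite (hdeg r').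
  by split=> //; exists (c j0).
move=> s v Iv gv lt; rewrite /dvdp.
have [||| b -> hb] := span s (v %% f).
- exact: (ideal_modp ID IM fm If).
- exact: (gr_modp fm gf sf).
- exact: (size_modf fm sf).
rewrite big1 // => j _; case: (hb j) => [-> | [r' Er' _]]; first by rewrite scale0r.
by case: (hlow j r' s).
Qed.

(** Let [a] be an inverse of [gm] modulo [f] on the line [x0 = 0].  The ratio
    carries [dlt] times a lift of [a] to a form whose restriction is [1].  This
    form plays for the new divisor the role of [dlt]. *)
Lemma ratio_avoids h gm : coprimep F (evp gm) ->
  (forall s v, I v -> gr s v -> exists y, f %| gm * v - dlt * y /\
        (y = 0 \/ exists2 r', (r' + h)%N = s & gr r' y)) ->
  exists s v y, [/\ I v, f %| gm * v - dlt * y, gr s y & evp y = 1].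
Proof.
move=> cop psi; have /Bezout_eq1_coprimepP [[b a] /= Eab] := cop.
have [al [gal eal]] := graded_lift (leqnSn (size a)).
have Iv : I (al * dlt) by apply: IM.
have [y [Ey gy]] := psi _ _ Iv (grM gal gdlt).
have dv1 : F %| evp y - 1.
  have evE : evp (gm * (al * dlt) - dlt * y) = evp gm * a - evp y.
    by rewrite evpB !evpM evdlt eal mulr1 mul1r.
  have := dvdF_evp Ey; rewrite evE.
  have -> : evp y - 1 = - ((evp gm * a - evp y) + b * F).
    by rewrite -Eab !opprD opprK [a * _]mulrC addrA addrAC [- _ + _ in RHS]addrC.
  by move=> dv; rewrite dvdpNr dvdp_add // dvdp_mull.
have ey : evp (y %% f) = 1.
  rewrite (evp_modp fm sf) -/F; apply/esym.
  apply: (Pdiv.Field.modpP (q := (evp y - 1) %/ F)).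
    by rewrite divpK // subrK.
  by rewrite sF' size_poly1.
have [s gys] : exists s, gr s y.
  case: gy => [y0 | [r _ g]]; last by exists r.
  by exists 0%N; rewrite y0; apply: gr0.
exists s, (al * dlt), (y %% f); split=> //; last exact: (gr_modp fm gf sf).
have -> : gm * (al * dlt) - dlt * (y %% f)
   = (gm * (al * dlt) - dlt * y) + dlt * (y - y %% f) by rewrite mulrBr addrA subrK.
by apply: dvdp_add => //; rewrite dvdp_mull // dvd_submod.
Qed.

(** Since [gm] is invertible on [f = x0 = 0], the element [v] of [I] is
    divisible by [x0] modulo [f] as well. *)
Lemma ratio_saturated gm s v y : coprimep F (evp gm) -> I v -> gr s v ->
  f %| gm * v - dlt * (x0 *: y) -> exists2 v', I v' & f %| gm * v' - dlt * y.
Proof.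
move=> cop Iv gv dv; pose w := v %% f.
have dw : f %| gm * w - dlt * (x0 *: y).
  have -> : gm * w - dlt * (x0 *: y)
     = (gm * v - dlt * (x0 *: y)) - gm * (v - w) by rewrite mulrBr opprB [RHS]addrC addrA subrK.
  by apply: dvdp_sub => //; rewrite dvdp_mull // dvd_submod.
have e0 : evp w = 0.
  have evE : evp (gm * w - dlt * (x0 *: y)) = evp gm * evp w.
    by rewrite evpB !evpM evpZ ev_x0 scale0r mulr0 subr0.
  have := dvdF_evp dw; rewrite evE Gauss_dvdpr // /dvdp modp_small.
    by move/eqP.
  by rewrite sF' ltnS (leq_trans (size_poly _ _)) // (size_modf fm sf).
have Iw : I w by exact: (ideal_modp ID IM fm If).
have [w0 | [s' [w' [_ _ _ Ew]]]] := evp_eq0_div (gr_modp fm gf sf gv) e0.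
  exists 0; first by rewrite -w0.
  move: dw; rewrite /w w0 !mulr0 !sub0r !dvdpNr -scalerAr dvdpZr //.
  exact: mpolyX_neq0.
exists w'; first by apply: Isat; rewrite -Ew.
move: dw; rewrite /w Ew -!scalerAr -scalerBr dvdpZr //; exact: mpolyX_neq0.
Qed.

Lemma ratio_min n h gm s v y : (n <= d)%N ->
  (forall s v, I v -> gr s v -> (s < n + h)%N -> f %| v) ->
  I v -> gr (s + h) v -> gr s y -> f %| gm * v - dlt * y -> y != 0 -> (n <= s)%N.
Proof.
move=> nd low Iv gv gy dv; apply: contraNT; rewrite -ltnNge => lt.
have fv : f %| v by apply: low gv _ => //; rewrite ltn_add2r.
have fy : f %| y.
  apply: (graded_regular gdlt _ gy); first by rewrite evdlt coprimep1.
  by rewrite -dvdpNr; move: dv; rewrite dvdp_addr // dvdp_mull.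
move: fy; rewrite /dvdp modp_small // sf ltnS (leq_trans (size_gr gy)) //.
exact: leq_trans nd.
Qed.

End Twist.

(** * Projection of the plane curve to a line *)

Lemma mpoly_morph_ext (k : fieldType) n (S : nzRingType) (g h : {rmorphism {mpoly k[n]} -> S}) :
  (forall c, g c%:MP = h c%:MP) -> (forall i, g 'X_i = h 'X_i) -> g =1 h.
Proof.
move=> eC eX; elim/mpolyind => [|c m p _ _ IH]; first by rewrite !rmorph0.
rewrite !rmorphD IH -mul_mpolyC !rmorphM eC mpolyXE_id !rmorph_prod /=.
by congr (_ * _ + _); apply: eq_bigr => i _; rewrite !rmorphXn eX.
Qed.

Lemma pihomogM (k : fieldType) n d s (P C : {mpoly k[n]}) : P \is d.-homog ->
  pihomog mdeg (d + s) (P * C) = P * pihomog mdeg s C.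
Proof.
move=> hP; elim/mpolyind: C => [|c m p _ _ IH]; first by rewrite raddf0 mulr0 raddf0.
rewrite mulrDr !raddfD /= mulrDr IH; congr (_ + _).
rewrite -scalerAr !linearZ /= -scalerAr; congr (_ *: _); rewrite pihomogX.
have hX : P * 'X_[m] \is (d + mdeg m).-homog by apply: dhomogM => //; rewrite dhomogX.
case: eqP => [Em | /eqP ne]; first by rewrite pihomog_dE // -Em.
by rewrite mulr0 (pihomog_ne0 _ hX) // eqn_add2l.
Qed.

Lemma pihomogM_lt (k : fieldType) n d s (P C : {mpoly k[n]}) : P \is d.-homog ->
  (s < d)%N -> pihomog mdeg s (P * C) = 0.
Proof.
move=> hP lt; elim/mpolyind: C => [|c m p _ _ IH]; first by rewrite mulr0 raddf0.
rewrite mulrDr raddfD /= IH addr0 -scalerAr linearZ /=.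
have hX : P * 'X_[m] \is (d + mdeg m).-homog by apply: dhomogM => //; rewrite dhomogX.
by rewrite (pihomog_ne0 _ hX) ?scaler0 //; lia.
Qed.

Lemma homog_ind (k : fieldType) n (P : {mpoly k[n]} -> Prop) (C : {mpoly k[n]}) :
  P 0 -> (forall a b, P a -> P b -> P (a + b)) ->
  (forall s, P (pihomog mdeg s C)) -> P C.
Proof.
move=> P0 PD Ps; rewrite (pihomog_partitionE (leqnn (mmeasure mdeg C))).
by apply: big_ind.
Qed.

Lemma dhomog_exp1 (k : fieldType) n (P : {mpoly k[n]}) m :
  P \is 1.-homog -> P ^+ m \is m.-homog.
Proof. by move=> /(dhomogMn m); rewrite mul1n. Qed.

Section Coordinates.
Variables (k : fieldType) (q : k).
Local Notation B := {mpoly k[2]}.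
Local Notation R := {mpoly k[3]}.
Local Notation X0 := ('X_(0 : 'I_3) : R).
Local Notation X1 := ('X_(1 : 'I_3) : R).
Local Notation X2 := ('X_(2 : 'I_3) : R).

(** The projection from the point [(0 : q : 1)]: polynomials in three variables
    are seen as polynomials in [X_2] over the ring generated by [X_0] and
    [X_1 - q X_2]. *)
Definition to_cone_var (i : 'I_3) : {poly B} :=
  if i == 0 then ('X_0)%:P else if i == 1 then ('X_1)%:P + (q%:MP)%:P * 'X else 'X.
Definition to_cone : R -> {poly B} := mmap (polyC \o @mpolyC 2 k) to_cone_var.
HB.instance Definition _ := GRing.RMorphism.copy to_cone to_cone.

Definition of_cone_var (i : 'I_2) : R := if i == 0 then X0 else X1 - q%:MP * X2.
Definition of_cone0 : B -> R := mmap (@mpolyC 3 k) of_cone_var.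
HB.instance Definition _ := GRing.RMorphism.copy of_cone0 of_cone0.
Definition of_cone : {poly B} -> R := horner_eval X2 \o map_poly of_cone0.
HB.instance Definition _ := GRing.RMorphism.copy of_cone of_cone.

Lemma of_coneC b : of_cone b%:P = of_cone0 b.
Proof. by rewrite /of_cone /= map_polyC /= /horner_eval hornerC. Qed.
Lemma of_coneX : of_cone 'X = X2.
Proof. by rewrite /of_cone /= map_polyX /horner_eval hornerX. Qed.
Lemma to_coneC c : to_cone c%:MP = (c%:MP)%:P.
Proof. by rewrite /to_cone mmapC. Qed.
Lemma to_coneX i : to_cone 'X_i = to_cone_var i.
Proof. by rewrite /to_cone mmapX mmap1U. Qed.
Lemma of_cone0C c : of_cone0 c%:MP = c%:MP.
Proof. by rewrite /of_cone0 mmapC. Qed.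
Lemma of_cone0X i : of_cone0 'X_i = of_cone_var i.
Proof. by rewrite /of_cone0 mmapX mmap1U. Qed.

Lemma to_coneM P Q : to_cone (P * Q) = to_cone P * to_cone Q.
Proof. exact: rmorphM. Qed.
Lemma to_coneD P Q : to_cone (P + Q) = to_cone P + to_cone Q.
Proof. exact: rmorphD. Qed.
Lemma to_coneB P Q : to_cone (P - Q) = to_cone P - to_cone Q.
Proof. exact: rmorphB. Qed.
Lemma of_coneM p p' : of_cone (p * p') = of_cone p * of_cone p'.
Proof. exact: rmorphM. Qed.
Lemma of_coneD p p' : of_cone (p + p') = of_cone p + of_cone p'.
Proof. exact: rmorphD. Qed.
Lemma of_coneB p p' : of_cone (p - p') = of_cone p - of_cone p'.
Proof. exact: rmorphB. Qed.

Lemma to_coneK : cancel to_cone of_cone.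
Proof.
apply: (mpoly_morph_ext (g := of_cone \o to_cone) (h := idfun)) => [c|i] /=.
  by rewrite to_coneC of_coneC of_cone0C.
rewrite to_coneX /to_cone_var; case: eqP => [-> | /eqP n0].
  by rewrite of_coneC of_cone0X.
case: eqP => [-> | /eqP n1].
  by rewrite rmorphD rmorphM /= !of_coneC of_coneX of_cone0X of_cone0C subrK.
rewrite of_coneX; congr ('X_ _); move: i n0 n1.
by case=> [[|[|[|//]]] lt] //= _ _; apply/val_inj.
Qed.

Lemma of_coneK : cancel of_cone to_cone.
Proof.
move=> p; have base b : to_cone (of_cone0 b) = b%:P.
  apply: (mpoly_morph_ext (g := to_cone \o of_cone0) (h := polyC)) => [c|i] /=.
    by rewrite of_cone0C to_coneC.
  rewrite of_cone0X /of_cone_var; case: eqP => [-> | /eqP n0]; first by rewrite to_coneX.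
  rewrite rmorphB rmorphM /= !to_coneX to_coneC /= addrK.
  congr (('X_ _)%:P); move: i n0.
  by case=> [[|[|//]] lt] //= _; apply/val_inj.
elim/poly_ind: p => [|p c IH]; first by rewrite !rmorph0.
rewrite !rmorphD !rmorphM /= IH of_coneC base of_coneX to_coneX.
by [].
Qed.

Lemma to_cone_gr s P : P \is s.-homog -> gr s (to_cone P).
Proof.
move=> /dhomogP hP; rewrite [P]mpolyE rmorph_sum big_seq; apply: gr_sum => m /hP /= <-.
rewrite -mul_mpolyC rmorphM /= to_coneC mul_polyC; apply: grZk.
rewrite mpolyXE_id rmorph_prod mdegE /=.
have E (n : nat) (r : seq 'I_3) : gr (\sum_(i <- r) m i)%N (\prod_(i <- r) to_cone ('X_i ^+ m i)).
  elim: r => [|i r IH]; first by rewrite !big_nil; apply: gr1.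
  rewrite !big_cons; apply: grM => //; rewrite rmorphXn /= to_coneX.
  elim: (m i) => [|a IHa]; first exact: gr1.
  rewrite exprS -add1n; apply: grM => //; rewrite /to_cone_var.
  have hx (j : 'I_2) : gr 1 (('X_j : B)%:P) by apply: grC; rewrite dhomogX /= mdeg1.
  case: eqP => // _; case: eqP => // _; last exact: grX.
  by apply: grD => //; rewrite mul_polyC; apply: grZk; apply: grX.
exact: E 0%N _.
Qed.

Lemma of_cone_homog s p : gr s p -> of_cone p \is s.-homog.
Proof.
have X_homog (i : 'I_3) : ('X_i : R) \is 1.-homog by rewrite dhomogX /= mdeg1.
have hv i : of_cone_var i \is 1.-homog.
  rewrite /of_cone_var; case: eqP => // _; apply: rpredB => //.
  by rewrite mul_mpolyC; apply: dhomogZ.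
have hb r b : b \is r.-homog -> of_cone0 b \is r.-homog.
  move=> /dhomogP h; rewrite [b]mpolyE rmorph_sum big_seq; apply: rpred_sum => m /h /= <-.
  rewrite -mul_mpolyC rmorphM /= of_cone0C mul_mpolyC; apply: dhomogZ.
  rewrite mpolyXE_id rmorph_prod mdegE /= !big_ord_recl !big_ord0 mulr1 addn0.
  rewrite !rmorphXn /= !of_cone0X.
  by apply: dhomogM; apply: dhomog_exp1.
move=> gp; rewrite -[p]coefK poly_def rmorph_sum; apply: rpred_sum => i _.
rewrite -mul_polyC rmorphM rmorphXn /= of_coneC of_coneX.
case: (gr_homog i gp) => [-> | [r <- h]]; first by rewrite rmorph0 mul0r rpred0.
by apply: dhomogM; [apply: hb | apply: dhomog_exp1].
Qed.

End Coordinates.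

Arguments to_cone_gr {k} q [s P].
Arguments of_cone_homog {k} q [s p].

(** * Linear equivalence given by a fraction *)

Section LinearEquivalence.
Variables (k : fieldType) (S V1 V2 : closed_subscheme k) (G G' : {mpoly k[3]}) (r h : nat).
Local Notation R := {mpoly k[3]}.

Lemma hidealN (V : closed_subscheme k) a : V a -> V (- a).
Proof. by rewrite -mulN1r; apply: hidealM. Qed.
Lemma hidealB (V : closed_subscheme k) a b : V a -> V b -> V (a - b).
Proof. by move=> ha hb; apply: hidealD => //; apply: hidealN. Qed.
Lemma hideal_sub (V : closed_subscheme k) a b : V (a - b) -> V b -> V a.
Proof. by move=> hab hb; rewrite -[a](subrK b); apply: hidealD. Qed.
Lemma hidealZ (V : closed_subscheme k) c a : V a -> V (c *: a).
Proof. by rewrite -mul_mpolyC; apply: hidealM. Qed.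
Lemma hidealZ_inv (V : closed_subscheme k) c a : c != 0 -> V (c *: a) -> V a.
Proof. by move=> nz /(hidealZ c^-1); rewrite scalerA mulVf // scale1r. Qed.

Hypotheses (hG : G \is (r + h).-homog) (hG' : G' \is r.-homog).
Hypotheses (regG : forall a, S (G * a) -> S a) (regG' : forall a, S (G' * a) -> S a).
Hypothesis forth : forall a, V2 a -> exists2 y, V1 y & S (G' * a - G * y).
Hypothesis back : forall y, V1 y -> exists2 a, V2 a & S (G' * a - G * y).

Let rel a y := S (G' * a - G * y).

(** Relations modulo [S] between elements of [V2] are the same as relations
    between their images in [V1]; all the axioms of an isomorphism of sheaves
    follow from this. *)
Lemma rel_comb a1 y1 a2 y2 c1 c2 : rel a1 y1 -> rel a2 y2 ->
  S (c1 * a1 - c2 * a2) <-> S (c1 * y1 - c2 * y2).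
Proof.
move=> h1 h2.
have E : S (G' * (c1 * a1 - c2 * a2) - G * (c1 * y1 - c2 * y2)).
  have -> : G' * (c1 * a1 - c2 * a2) - G * (c1 * y1 - c2 * y2)
    = c1 * (G' * a1 - G * y1) - c2 * (G' * a2 - G * y2) by ring.
  by apply: hidealB; apply: hidealM.
split=> H.
  apply: regG; rewrite -[G * _](subKr (G' * (c1 * a1 - c2 * a2))).
  by apply: hidealB => //; apply: hidealM.
by apply: regG'; apply: hideal_sub E _; apply: hidealM.
Qed.

Lemma forth_homog a e : V2 a -> a \is (e + h).-homog ->
  exists y, [/\ V1 y, y \is e.-homog & rel a y].
Proof.
move=> Va ha; have [y Vy /(hideal_homog (r + h + e)) H] := forth Va.
exists (pihomog mdeg e y); split; [exact: hideal_homog | exact: pihomogP |].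
move: H; rewrite raddfB /= (pihomogM _ _ hG) pihomog_dE //.
by rewrite -addnA [(h + e)%N]addnC; apply: dhomogM.
Qed.

Lemma back_homog y e : V1 y -> y \is e.-homog ->
  exists a, [/\ V2 a, a \is (e + h).-homog & rel a y].
Proof.
move=> Vy hy; have [a Va /(hideal_homog (r + (e + h))) H] := back Vy.
exists (pihomog mdeg (e + h) a); split; [exact: hideal_homog | exact: pihomogP |].
move: H; rewrite raddfB /= (pihomogM _ _ hG') [pihomog _ _ (G * y)]pihomog_dE //.
by rewrite [(e + h)%N]addnC addnA; apply: dhomogM.
Qed.

Lemma forth_choice : exists Y : R -> R, forall a, V2 a ->
  [/\ V1 (Y a), rel a (Y a) & forall e, a \is (e + h).-homog -> Y a \is e.-homog].
Proof.
have ex (a : R) : exists y, V2 a ->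
  [/\ V1 y, rel a y & forall e, a \is (e + h).-homog -> y \is e.-homog].
  have [Va | nVa] := classic (V2 a); last by exists 0.
  have [-> | nz] := eqVneq a 0.
    exists 0 => _; split; [exact: hideal0 | | by move=> e _; apply: dhomog0].
    by rewrite /rel !mulr0 subrr; apply: hideal0.
  have [[e he] | H] := classic (exists e, a \is (e + h).-homog).
    have [y [Vy hy ry]] := forth_homog Va he; exists y => _; split=> // e' he'.
    by have /addIn <- := dhomog_uniq nz he he'.
  have [y Vy ry] := forth Va.
  by exists y => _; split=> // e he; case: H; exists e.
by have [Y HY] := functional_choice _ ex; exists Y.
Qed.

(** The isomorphism is multiplication by the fraction [G' / G].  A section
    [a / g ^ m] is first written [(g ^ h a) / g ^ (m + h)], because the degree of
    [a] may be smaller than [h], and the image of [a] would then have a negative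
    degree. *)
Lemma linearly_equivalent_ratio : linearly_equivalent S V1 V2 h%:Z.
Proof.
have [Y HY] := forth_choice.
exists (fun g s => (Y (g ^+ h * s.1), (s.2 + h)%N)).
have V2g (g a : R) : V2 a -> V2 (g ^+ h * a) by apply: hidealM.
have Yrel (g a : R) : V2 a -> rel (g ^+ h * a) (Y (g ^+ h * a)).
  by move=> /(V2g g) /HY[].
split=> /=.
- move=> g d [a m] [_ hg d0] /= [/= Va [e [he Ee]]].
  have Vga := V2g g a Va; have [VY _ hY] := HY _ Vga; split=> //.
  exists (d * h + e - h)%N; split.
    apply: hY; rewrite subnK; first by apply: dhomogM => //; apply: dhomogMn.
    by rewrite (leq_trans (leq_pmull h d0)) ?leq_addr.
  have le : (h <= d * h)%N by rewrite leq_pmull.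
  by rewrite /= mulnDl [(h * d)%N]mulnC; lia.
- move=> g d [a1 m1] [a2 m2] _ [/= V1a _] [/= V2a _]; rewrite /eq_section /=.
  have K := rel_comb _ _ (Yrel g a1 V1a) (Yrel g a2 V2a).
  split=> [[N HN] | [N HN]].
    exists N; rewrite mulrBr !mulrA; apply/K.
    have -> : g ^+ N * g ^+ (m2 + h) * (g ^+ h * a1) - g ^+ N * g ^+ (m1 + h) * (g ^+ h * a2)
      = g ^+ h * g ^+ h * (g ^+ N * (g ^+ m2 * a1 - g ^+ m1 * a2)).
      by rewrite !exprD; ring.
    exact: hidealM.
  exists (N + (h + h))%N; move: HN; rewrite mulrBr !mulrA => /K.
  by congr (S _); rewrite !exprD; ring.
- move=> g d [b m] gb [/= Vb [e [he Ee]]].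
  have [a [Va ha rab]] := back_homog Vb he.
  exists (a, m); split.
    by split=> //=; exists (e + h)%N; split=> //; lia.
  exists 0%N; rewrite /= expr0 mul1r; apply/(rel_comb _ _ (Yrel g a Va) rab).
  by rewrite exprD mulrA subrr; apply: hideal0.
- move=> g d [a1 m1] [a2 m2] _ [/= V1a _] [/= V2a _]; exists 0%N; rewrite expr0 mul1r /=.
  have VA : V2 (g ^+ m2 * a1 + g ^+ m1 * a2) by apply: hidealD; apply: hidealM.
  have rA : rel (g ^+ (m2 + h) * (g ^+ h * a1) + g ^+ (m1 + h) * (g ^+ h * a2))
     (g ^+ (m2 + h) * Y (g ^+ h * a1) + g ^+ (m1 + h) * Y (g ^+ h * a2)).
    have := hidealD (hidealM (g ^+ (m2 + h)) (Yrel g a1 V1a))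
                    (hidealM (g ^+ (m1 + h)) (Yrel g a2 V2a)).
    by congr (S _); ring.
  apply/(rel_comb _ _ (Yrel g _ VA) rA).
  by rewrite (_ : _ - _ = 0); [apply: hideal0 | rewrite !exprD; ring].
- move=> g d [c m'] [a m] _ _ [/= Va _]; exists 0%N; rewrite expr0 mul1r /=.
  have Vca : V2 (c * a) by apply: hidealM.
  have rA : rel (c * (g ^+ h * a)) (c * Y (g ^+ h * a)).
    by have := hidealM c (Yrel g a Va); congr (S _); ring.
  apply/(rel_comb _ _ (Yrel g _ Vca) rA).
  by rewrite (_ : _ - _ = 0); [apply: hideal0 | rewrite !exprD; ring].
move=> g d g' d' u N [a m] _ _ [_ Su] [/= Va _]; exists 0%N; rewrite expr0 mul1r /=.
have Vua : V2 (u ^+ m * a) by apply: hidealM.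
have rA : rel (u ^+ (m + h) * (g ^+ h * a)) (u ^+ (m + h) * Y (g ^+ h * a)).
  by have := hidealM (u ^+ (m + h)) (Yrel g a Va); congr (S _); ring.
apply/(rel_comb _ _ (Yrel g' _ Vua) rA).
have -> : g' ^+ (N * (m + h)) * (g' ^+ h * (u ^+ m * a))
   - g' ^+ (N * m + h) * (u ^+ (m + h) * (g ^+ h * a))
  = g' ^+ (N * m) * g' ^+ h * u ^+ m * a * ((g' ^+ N) ^+ h - (u * g) ^+ h).
  by rewrite mulnDr !exprD exprMn -exprM; ring.
by rewrite subrXX; apply: hidealM; rewrite mulrC; apply: hidealM.
Qed.

End LinearEquivalence.

(** * Zero-dimensional schemes *)

(** The line [X_0 = 0] does not meet [V]: modulo the ideal of [V], every form
    of large degree is divisible by [X_0]. *)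
Definition avoids_line (k : fieldType) (V : closed_subscheme k) : Prop :=
  exists S0 : nat, forall s F, (S0 <= s)%N -> F \is s.+1.-homog ->
    exists2 F', F' \is s.-homog & V (F - 'X_0 * F').

Section Zerodimensional.
Variable k : closedFieldType.
Local Notation R := {mpoly k[3]}.
Local Notation X0 := ('X_(0 : 'I_3) : R).
Local Notation X1 := ('X_(1 : 'I_3) : R).
Local Notation X2 := ('X_(2 : 'I_3) : R).

Lemma hideal_sum (V : closed_subscheme k) (J : Type) (l : seq J) (P : pred J) (F : J -> R) :
  (forall j, P j -> V (F j)) -> V (\sum_(j <- l | P j) F j).
Proof. by move=> H; apply: big_ind => //; [apply: hideal0 | apply: hidealD]. Qed.

Lemma hideal_components (V : closed_subscheme k) F :
  (forall s, V (pihomog mdeg s F)) -> V F.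
Proof. by move=> H; apply: homog_ind H; [apply: hideal0 | apply: hidealD]. Qed.

Definition affine_point (a b : k) (i : 'I_3) : k :=
  if i == 0 then 1 else if i == 1 then a else b.

(** Modulo the ideal of a point, a form is its value times a power of [X_0]. *)
Lemma hideal_eval (V : closed_subscheme k) a b s F :
  V (X1 - a *: X0) -> V (X2 - b *: X0) -> F \is s.-homog ->
  V (F - F.@[affine_point a b] *: X0 ^+ s).
Proof.
move=> h1 h2 /dhomogP hF.
have hX i : V ('X_i - affine_point a b i *: X0).
  rewrite /affine_point; case: eqP => [-> | /eqP n0].
    by rewrite scale1r subrr; apply: hideal0.
  case: eqP => [-> // | /eqP n1]; have -> // : i = 2%:R.
  by move: i n0 n1 => [[|[|[|//]]] lt] //= _ _; apply/val_inj.
have hexp i (n : nat) : V ('X_i ^+ n - affine_point a b i ^+ n *: X0 ^+ n).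
  by rewrite -exprZn subrXX mulrC; apply: hidealM.
have hm (m : 'X_{1..3}) (l : seq 'I_3) :
  V (\prod_(i <- l) 'X_i ^+ m i - (\prod_(i <- l) affine_point a b i ^+ m i) *:
       X0 ^+ (\sum_(i <- l) m i)).
  elim: l => [|i l IH].
    by rewrite !big_nil expr0 scale1r subrr; apply: hideal0.
  rewrite !big_cons exprD.
  set x := 'X_i ^+ _; set y := \prod_(j <- l) 'X_j ^+ _; set u := X0 ^+ m i.
  set v := X0 ^+ (\sum_(j <- l) _); set al := _ ^+ _; set be := \prod_(j <- l) _.
  have -> : x * y - (al * be) *: (u * v) = y * (x - al *: u) + (al *: u) * (y - be *: v).
    rewrite -scalerA -!mul_mpolyC; ring.
  by apply: hidealD; apply: hidealM => //; apply: hexp.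
rewrite mevalE scaler_suml [X in X - _]mpolyE -sumrB big_seq.
apply: hideal_sum => m /hF /= ms.
rewrite -scalerA -scalerBr -ms mdegE mpolyXE_id; apply: hidealZ; exact: hm.
Qed.

Lemma dhomog_eq0 d (F : R) : F \is d.-homog ->
  (forall m : 'X_{1..3 < d.+1}, F@_m = 0) -> F = 0.
Proof.
move=> /dhomogP hF H; apply/mpolyP => m; rewrite mcoeff0.
case: (boolP (m \in msupp F)) => [/[dup] mF /hF /= E|]; last exact: memN_msupp_eq0.
by have lt : (mdeg m < d.+1)%N; [rewrite E | exact: (H (BMultinom lt))].
Qed.

Lemma dhomog_dependent d n (F : 'I_n -> R) :
  (#|{: 'X_{1..3 < d.+1}}| < n)%N -> (forall i, F i \is d.-homog) ->
  exists c : 'I_n -> k, (exists i, c i != 0) /\ \sum_i c i *: F i = 0.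
Proof.
move=> ltn hF; pose A : 'M[k]_(n, #|{: 'X_{1..3 < d.+1}}|) :=
  \matrix_(i, t) (F i)@_(enum_val t : 'X_{1..3 < d.+1}).
have : kermx A != 0.
  by rewrite -mxrank_eq0 mxrank_ker subn_eq0 -ltnNge (leq_ltn_trans _ ltn) ?rank_leq_col.
move: (kermx A) (mulmx_ker A) => K KA /matrix0Pn [i0 [j0 nz]].
exists (fun i => K i0 i); split; first by exists j0.
apply: (@dhomog_eq0 d); first by apply: rpred_sum => i _; apply: dhomogZ.
move=> m; rewrite raddf_sum /=.
have /matrixP/(_ i0 (enum_rank m)) := KA; rewrite !mxE => E.
by rewrite -[RHS]E; apply: eq_bigr => i _; rewrite mcoeffZ mxE enum_rankK.
Qed.

Definition homogenize M (p : {poly k}) (Z : R) : R :=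
  \sum_(i < M.+1) p`_i *: (X0 ^+ (M - i) * Z ^+ i).

(** The bound on the size matters: [homogenize M] drops the coefficients of
    degree greater than [M]. *)
Lemma homogenize_mulXsubC M (p : {poly k}) (a : k) (Z : R) : (size p <= M.+1)%N ->
  homogenize M.+1 (p * ('X - a%:P)) Z = homogenize M p Z * (Z - a *: X0).
Proof.
move=> sp; have top : p`_M.+1 = 0 by rewrite nth_default.
rewrite /homogenize [RHS]mulrBr mulr_suml.
rewrite (eq_bigr (fun i : 'I_M.+2 => (p * 'X)`_i *: (X0 ^+ (M.+1 - i) * Z ^+ i)
    - (a * p`_i) *: (X0 ^+ (M.+1 - i) * Z ^+ i))); last first.
  by move=> i _; rewrite mulrBr coefB coefMC scalerBl [p`_i * a]mulrC.
rewrite sumrB; congr (_ - _).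
  rewrite big_ord_recl coefMX /= scale0r add0r; apply: eq_bigr => i _.
  by rewrite /bump /= add1n coefMX /= subSS -scalerAl -mulrA -exprSr.
rewrite big_ord_recr /= top mulr0 scale0r addr0 mulr_suml; apply: eq_bigr => i _.
rewrite subSn; last by rewrite -ltnS.
by rewrite exprS -!mul_mpolyC mpolyCM; ring.
Qed.

Section Integral.
Variable P : closed_subscheme k.
Hypothesis iP : integral P.

Lemma integral_exp Z n : P (Z ^+ n) -> P Z.
Proof.
elim: n => [|n IH]; first by rewrite expr0; case: iP.
by rewrite exprS; case: iP => _ h /h [].
Qed.

(** A binary form in [X_0] and [Z] splits into linear factors, and an integral
    scheme lies on one of them; a factor [X_0] is excluded. *)
Lemma integral_homogenize M (p : {poly k}) Z : ~ P X0 -> p != 0 -> (size p <= M.+1)%N ->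
  P (homogenize M p Z) -> exists a, P (Z - a *: X0).
Proof.
move=> nX0; elim: M p => [|M IH] p nz sp.
  rewrite /homogenize big_ord1 subnn !expr0 mulr1 => /hidealZ_inv H.
  case: iP => n1 _; case: n1; apply: H; apply: contraNneq nz => p0.
  by rewrite [p]size1_polyC // p0.
have [s1 | /closed_rootP] := eqVneq (size p) 1%N; last first.
  case=> a /factor_theorem [q Eq].
  have q0 : q != 0 by apply: contraNneq nz => q0; rewrite Eq q0 mul0r.
  have sq : (size q <= M.+1)%N.
    by move: sp; rewrite Eq size_Mmonic ?monicXsubC // size_XsubC addn2.
  by rewrite Eq homogenize_mulXsubC //; case: iP => _ h /h [/(IH q q0 sq) | H]; last exists a.
rewrite /homogenize big_ord_recl big1 => [|i _]; last first.
  by rewrite nth_default ?scale0r // s1.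
rewrite addr0 subn0 expr0 mulr1 => /hidealZ_inv H; case: nX0.
apply: (@integral_exp _ M.+1); apply: H; apply: contraNneq nz => p0.
by rewrite [p]size1_polyC ?s1 // p0.
Qed.

End Integral.

(** If [P] were on the line [X_0 = 0], then powers of all the variables would
    vanish on [P], which would be empty. *)
Lemma avoids_lineX0 (V P : closed_subscheme k) : avoids_line V -> subscheme P V ->
  integral P -> ~ P X0.
Proof.
move=> [S0 H] VP iP PX0; case: (iP) => n1 _; apply: n1; apply: hideal_sat => j.
exists S0.+1; rewrite mulr1.
have [||F' _ /VP h] := H S0 ('X_j ^+ S0.+1); first exact: leqnn.
  by apply: dhomog_exp1; rewrite dhomogX /= mdeg1.
by apply: hideal_sub h _; rewrite mulrC; apply: hidealM.
Qed.

Lemma avoids_line_reduce (V : closed_subscheme k) S0 :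
  (forall s F, (S0 <= s)%N -> F \is s.+1.-homog ->
    exists2 F', F' \is s.-homog & V (F - X0 * F')) ->
  forall n F, F \is (n + S0).-homog -> exists2 F', F' \is S0.-homog & V (F - X0 ^+ n * F').
Proof.
move=> H; elim=> [|n IH] F hF.
  by exists F => //; rewrite expr0 mul1r subrr; apply: hideal0.
have [F1 h1 V1] := H (n + S0)%N F (leq_addl _ _) hF.
have [F2 h2 V2] := IH F1 h1; exists F2 => //.
have -> : F - X0 ^+ n.+1 * F2 = (F - X0 * F1) + X0 * (F1 - X0 ^+ n * F2).
  by rewrite exprS; ring.
by apply: hidealD => //; apply: hidealM.
Qed.

(** Modulo [V], the forms of a given large degree are multiples, by a power of
    [X_0], of forms of degree [S0].  Hence sufficiently many products of powers
    of [X_0] and ['X_j] are linearly dependent modulo [V], so a binary form in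
    these two variables vanishes on [P]. *)
Lemma avoids_line_integral (V P : closed_subscheme k) j : avoids_line V ->
  subscheme P V -> integral P -> exists a, P ('X_j - a *: X0).
Proof.
move=> av VP iP; have nX0 := avoids_lineX0 av VP iP.
have [S0 /avoids_line_reduce red] := av.
pose L := #|{: 'X_{1..3 < S0.+1}}|.
have ex (i : 'I_(L + S0).+1) : exists F : R, F \is S0.-homog /\
    V (X0 ^+ (L + S0 - i) * 'X_j ^+ i - X0 ^+ L * F).
  have iL : (i <= L + S0)%N by rewrite -ltnS.
  have [|F hF VF] := red L (X0 ^+ (L + S0 - i) * 'X_j ^+ i); last by exists F.
  rewrite -[X in X.-homog](subnK iL); apply: dhomogM; apply: dhomog_exp1;
  by rewrite dhomogX /= mdeg1.
have [F HF] := functional_choice _ ex.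
have [|c [[i0 nz] Ec]] := dhomog_dependent _ (fun i => proj1 (HF i)).
  by rewrite ltnS leq_addr.
pose p := \poly_(i < (L + S0).+1) c (inord i).
have pc (i : 'I_(L + S0).+1) : p`_i = c i by rewrite coef_poly ltn_ord inord_val.
apply: (integral_homogenize (M := L + S0) (p := p) iP nX0).
- by apply: contraNneq nz => p0; rewrite -pc p0 coef0.
- exact: size_poly.
apply: VP; have E : \sum_i c i *: (X0 ^+ L * F i) = 0.
  rewrite -[RHS](mulr0 (X0 ^+ L)) -[X in _ = _ * X]Ec mulr_sumr.
  by apply: eq_bigr => i _; rewrite scalerAr.
rewrite /homogenize -[X in V X]subr0 -[X in V (_ - X)]E -sumrB; apply: hideal_sum => i _.
by rewrite pc -scalerBr; apply: hidealZ; case: (HF i).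
Qed.

(** By [avoids_line_integral] the integral scheme [P] is a point.  A form on
    [Q] is congruent modulo the ideal of this point to a multiple of a power of
    [X_0]; as [Q] is not on the line [X_0 = 0], the multiple is zero. *)
Lemma pure_dim0_avoids (V : closed_subscheme k) : ~ V 1 -> avoids_line V -> pure_dim0 V.
Proof.
move=> nV1 av; split=> // P Q iP iQ PQ VP F; split; first exact: PQ.
move=> QF; apply: hideal_components => s.
have [a Pa] := avoids_line_integral 1 av VP iP.
have [b Pb] := avoids_line_integral 2%:R av VP iP.
have hF := pihomogP mdeg s F; have PE := hideal_eval Pa Pb hF.
apply: hideal_sub PE _; set c := meval _ _.
have [-> | nz] := eqVneq c 0; first by rewrite scale0r; apply: hideal0.
case: (avoids_lineX0 (V := V) av _ iQ); first by move=> H /VP /PQ.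
apply: (integral_exp iQ (n := s)); apply: (hidealZ_inv nz).
rewrite -[X in Q X](subKr (pihomog mdeg s F)); apply: hidealB.
  exact: hideal_homog.
by apply: PQ; apply: hideal_eval.
Qed.

End Zerodimensional.

(** * One step of the descent *)

Lemma size_monic_gr (k : fieldType) (f : {poly {mpoly k[2]}}) d :
  f \is monic -> gr d f -> size f = d.+1.
Proof.
move=> fm gf; have := gf (size f).-1 0%MM.
rewrite -lead_coefE (monicP fm) msupp1 inE eqxx mdeg0 add0n => <- //.
by rewrite prednK // size_poly_gt0 monic_neq0.
Qed.

Lemma monic_gr_top (k : fieldType) (f : {poly {mpoly k[2]}}) d :
  gr d f -> f`_d = 1 -> f \is monic.
Proof.
move=> gf f1; have d_lt : (d < size f)%N.
  by rewrite ltnNge; apply/negP => /leq_sizeP/(_ d (leqnn _))/eqP; rewrite f1 oner_eq0.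
have -> : f \is monic = (f`_(size f).-1 == 1) by rewrite monicE lead_coefE.
have -> : (size f).-1 = d by have := size_gr gf; lia.
by rewrite f1.
Qed.

Section Schemes.
Variable k : fieldType.
Local Notation R := {mpoly k[3]}.
Local Notation X0 := ('X_(0 : 'I_3) : R).

Lemma to_cone_dvd q (F0 P : R) : to_cone q F0 \is monic ->
  (exists C, P = C * F0) <-> to_cone q F0 %| to_cone q P.
Proof.
move=> fm; split=> [[C ->] | /(Pdiv.IdomainMonic.dvdpP fm)[c E]].
  by rewrite to_coneM dvdp_mull.
exists (of_cone q c); apply: (can_inj (to_coneK q)).
by rewrite E to_coneM of_coneK.
Qed.

Lemma curve_scheme q d (F0 : R) : (0 < d)%N -> F0 \is d.-homog -> to_cone q F0 \is monic ->
  exists S : closed_subscheme k, plane_curve S /\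
    forall P, S P <-> to_cone q F0 %| to_cone q P.
Proof.
move=> d0 hF fm; pose I (P : R) : Prop := to_cone q F0 %| to_cone q P.
have I0 : I 0 by rewrite /I rmorph0 dvdp0.
have ID P Q : I P -> I Q -> I (P + Q) by rewrite /I to_coneD; apply: dvdp_add.
have IM P Q : I Q -> I (P * Q) by rewrite /I to_coneM; apply: dvdp_mull.
have Ih e P : I P -> I (pihomog mdeg e P).
  move=> /(to_cone_dvd _ fm) [C ->]; rewrite mulrC; case: (ltnP e d) => le.
    by rewrite (pihomogM_lt _ hF).
  by rewrite -(subnKC le) (pihomogM _ _ hF) mulrC; apply: IM; apply: dvdpp.
have Is P : (forall j : 'I_3, exists N, I ('X_j ^+ N * P)) -> I P.
  move=> /(_ 0) [N]; rewrite /I to_coneM rmorphXn /= to_coneX /to_cone_var eqxx.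
  by rewrite -polyC_exp mul_polyC dvdpZr // expf_neq0 // mpolyX_neq0.
exists (ClosedSubscheme I0 ID IM Ih Is); split; last by move=> P; split.
exists d, F0; split; [exact: d0 | | exact: hF | ].
  by apply: contraTneq fm => ->; rewrite rmorph0 monicE lead_coef0 eq_sym oner_eq0.
by move=> P; split=> [/(to_cone_dvd _ fm) | /(to_cone_dvd _ fm)].
Qed.

Lemma hideal_regular (S : closed_subscheme k) d P : P \is d.-homog ->
  (forall s a, a \is s.-homog -> S (P * a) -> S a) -> forall a, S (P * a) -> S a.
Proof.
move=> hP H a Sa; apply: homog_ind => [|u v|s]; [exact: hideal0 | exact: hidealD |].
apply: (H s); first exact: pihomogP.
by rewrite -(pihomogM _ _ hP); apply: hideal_homog.
Qed.

(** The ideal of the new scheme is [(G' / G) V] modulo [S].  Saturation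
    with respect to [X_0], tested on forms, is enough for it to be saturated. *)
Lemma ratio_scheme (S V : closed_subscheme k) G G' r h :
  G \is (r + h).-homog -> G' \is r.-homog ->
  (forall s F v, F \is s.-homog -> v \is (s.+1 + h).-homog -> V v ->
     S (G' * v - G * (X0 * F)) -> exists2 w, V w & S (G' * w - G * F)) ->
  exists V1 : closed_subscheme k,
    [/\ forall F, V1 F <-> exists2 v, V v & S (G' * v - G * F),
      forall F, V1 (X0 * F) -> V1 F
    & forall s F, F \is s.-homog -> V1 F ->
        exists v, [/\ V v, v \is (s + h).-homog & S (G' * v - G * F)]].
Proof.
move=> hG hG' sat; pose Q F := exists2 v, V v & S (G' * v - G * F).
have Q0 : Q 0 by exists 0; rewrite ?mulr0 ?subrr; apply: hideal0.
have QD E F : Q E -> Q F -> Q (E + F).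
  move=> [v Vv Sv] [w Vw Sw]; exists (v + w); first exact: hidealD.
  rewrite (_ : _ - _ = (G' * v - G * E) + (G' * w - G * F)); last by ring.
  exact: hidealD.
have QM E F : Q F -> Q (E * F).
  move=> [v Vv Sv]; exists (E * v); first exact: hidealM.
  rewrite (_ : _ - _ = E * (G' * v - G * F)); last by ring.
  exact: hidealM.
have Qc s F : Q F -> exists v, [/\ V v, v \is (s + h).-homog
    & S (G' * v - G * pihomog mdeg s F)].
  move=> [v Vv /(hideal_homog (r + h + s))]; rewrite raddfB /= (pihomogM _ _ hG).
  rewrite -(addnA r h s) (addnC h s) (pihomogM _ _ hG') => Sv.
  by exists (pihomog mdeg (s + h) v); split=> //; [apply: hideal_homog | apply: pihomogP].
have Qh s F : Q F -> Q (pihomog mdeg s F).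
  by move=> /(Qc s) [v [Vv _ Sv]]; exists v.
have QX0 F : Q (X0 * F) -> Q F.
  move=> QF; apply: homog_ind => // s; have [v [Vv hv Sv]] := Qc s.+1 _ QF.
  apply: sat (pihomogP _ _ _) hv Vv _; move: Sv.
  by rewrite -(add1n s) (pihomogM (d := 1)) ?dhomogX //= mdeg1.
have Qs F : (forall j : 'I_3, exists N, Q ('X_j ^+ N * F)) -> Q F.
  move=> /(_ 0) [N]; elim: N => [|N IH]; first by rewrite expr0 mul1r.
  by rewrite exprS -mulrA => /QX0 /IH.
exists (ClosedSubscheme Q0 QD QM Qh Qs); split=> // s F hF /(Qc s).
by rewrite pihomog_dE.
Qed.

(** The projection from [(0 : q : 1)] is finite on some curve of degree [d]
    through [V], and [V] does not meet the line [X_0 = 0].  The second condition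
    is witnessed by a form which restricts to a power of [x1] on this line. *)
Record curve_position (q : k) (d : nat) (V : closed_subscheme k) : Prop := {
  position_curve : exists F0, [/\ V F0, F0 \is d.-homog & to_cone q F0 \is monic];
  position_avoid : exists t D, [/\ V D, D \is t.-homog & evp (to_cone q D) = 1]
}.

Definition least_degree (d : nat) (V : closed_subscheme k) : Prop :=
  forall s F, V F -> F \is s.-homog -> F != 0 -> (d <= s)%N.

Lemma least_degree_nonempty d V : (0 < d)%N -> least_degree d V -> ~ V 1.
Proof.
move=> d0 H V1; have := H 0%N 1 V1 (dhomog1 _ _) (oner_neq0 _).
by rewrite leqNgt d0.
Qed.

End Schemes.

Section Descent.
Variable k : closedFieldType.
Local Notation R := {mpoly k[3]}.
Local Notation X0 := ('X_(0 : 'I_3) : R).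

(** Modulo the curve, a form of large degree restricts on the line [X_0 = 0] to
    a multiple of the restriction of [D], which is a power of [x1]. *)
Lemma position_avoids_line q d (V : closed_subscheme k) : curve_position q d V -> avoids_line V.
Proof.
move=> [[F0 [VF hF fm]] [t [D [VD hD eD]]]]; exists (d + t)%N => s F le hP.
have gf := to_cone_gr q hF; have sf := size_monic_gr fm gf.
set f := to_cone q F0 in fm gf sf; set p := to_cone q F.
have gp : gr s.+1 p by apply: to_cone_gr.
have [|qq [gq eq]] := @graded_lift _ (evp (p %% f)) (s.+1 - t).
  apply: leq_trans (size_poly _ _) _; apply: leq_trans (size_modf fm sf p) _.
  by rewrite leqW // leq_subRL; lia.
pose w := p %% f - qq * to_cone q D.
have gw : gr s.+1 w.
  apply: grB; first exact: (gr_modp fm gf sf).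
  have ts : (t <= s.+1)%N by lia.
  exact: (eq_ind _ (fun n => gr n _) (grM gq (to_cone_gr q hD)) _ (subnK ts)).
have [c Ec] := Pdiv.IdomainMonic.dvdpP fm _ (dvd_submod fm p).
have Ew : F - of_cone q w = of_cone q c * F0 + of_cone q qq * D.
  rewrite -[F in LHS](to_coneK q) -{1}[F0](to_coneK q) -{1}[D](to_coneK q).
  rewrite -of_coneB -!of_coneM -of_coneD -/f -/p -Ec /w opprB.
  by rewrite addrCA [X in _ = of_cone q X]addrC.
have VFw : V (F - of_cone q w) by rewrite Ew; apply: hidealD; apply: hidealM.
have [|w0 | [s' [w' [[Es] gw' _ Ew']]]] := evp_eq0_div gw.
- by rewrite evpB evpM eq eD mulr1 subrr.
- by exists 0; [apply: dhomog0 | move: VFw; rewrite w0 rmorph0 mulr0].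
exists (of_cone q w'); first by rewrite Es; apply: of_cone_homog.
move: VFw; rewrite Ew' -mul_polyC of_coneM of_coneC of_cone0X /of_cone_var eqxx.
by [].
Qed.

Lemma pure_dim0_position q d n (V : closed_subscheme k) : (0 < n)%N ->
  curve_position q d V -> least_degree n V -> pure_dim0 V.
Proof.
move=> n0 pV mV; apply: pure_dim0_avoids (position_avoids_line pV).
exact: least_degree_nonempty mV.
Qed.

(** The elementary biliaison of [descent_ratio] on the curve [F0].  For
    [kap = 0] the form [F] defines a curve of degree [d - 1] whose projection is
    again finite, so that the step can be repeated; for [d = kap = 1] the new
    scheme lies on the two distinct lines [F0] and [F]. *)
Theorem descent q d kap (V : closed_subscheme k) :
  curve_position q d V -> least_degree d V -> (forall F, V (X0 * F) -> V F) ->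
  (0 < d)%N -> (kap <= 1)%N -> (0 < d.-1 + kap)%N ->
  exists (h : nat) V1, [/\ elementary_biliaison h%:Z V1 V,
    curve_position q d V1, least_degree (d.-1 + kap) V1,
    forall F, V1 (X0 * F) -> V1 F
    & exists F c, [/\ V1 F, F \is (d.-1 + kap).-homog, (size (to_cone q F) <= d)%N,
        c != 0 & (to_cone q F)`_d.-1 = c%:MP * 'X_1 ^+ kap]].
Proof.
move=> pV mV sV d0 kap1 n0; have nd : (d.-1 + kap <= d)%N by lia.
have [[F0 [VF hF fm]] [t [D [VD hD eD]]]] := pV.
have gf := to_cone_gr q hF; have sf := size_monic_gr fm gf.
have [S [Sc SE]] := curve_scheme d0 hF fm.
have gd := to_cone_gr q hD.
move Ef : (to_cone q F0) => f in fm gf sf SE; move Ed : (to_cone q D) => dlt in eD gd.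
pose I p := V (of_cone q p).
have ID p p' : I p -> I p' -> I (p + p') by rewrite /I of_coneD; apply: hidealD.
have IM p p' : I p' -> I (p * p') by rewrite /I of_coneM; apply: hidealM.
have oX0 p : of_cone q ('X_0 *: p) = X0 * of_cone q p.
  by rewrite -mul_polyC of_coneM of_coneC of_cone0X.
have Is p : I ('X_0 *: p) -> I p by rewrite /I oX0; apply: sV.
have If : I f by rewrite /I -Ef to_coneK.
have Id : I dlt by rewrite /I -Ed to_coneK.
have Imin s v : I v -> gr s v -> v != 0 -> (d <= s)%N.
  move=> Iv gv nz; apply: mV Iv (of_cone_homog q gv) _.
  by apply: contraNneq nz => z; rewrite -[v](of_coneK q) z rmorph0.
have [h [r [gm [Er ggm cop [psi [s1 [v1 [y1 [Iv1 gv1 Ey1 gy1 [sy1 [c c0 Ty1]]]]]] low]]]]] :=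
  descent_ratio ID IM Is fm sf gf If d0 Id gd eD Imin kap1.
have SF0 : S F0 by apply/SE; rewrite Ef dvdpp.
have SV : subscheme V S.
  by move=> F /SE; rewrite -Ef => /to_cone_dvd[|C ->]; [rewrite Ef | apply: hidealM].
pose G' := of_cone q gm.
have hG' : G' \is r.-homog by apply: of_cone_homog.
have hG : D \is (r + h).-homog by rewrite Er.
have Srel v y : S (G' * v - D * y) <-> f %| gm * to_cone q v - dlt * to_cone q y.
  by rewrite SE to_coneB !to_coneM of_coneK Ed.
have copD : coprimep (evp f) (evp dlt) by rewrite eD coprimep1.
have regG : forall a, S (D * a) -> S a.
  apply: (hideal_regular hD) => s a ha; rewrite !SE to_coneM Ed.
  exact: (graded_regular fm sf gf gd copD (to_cone_gr q ha)).
have regG' : forall a, S (G' * a) -> S a.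
  apply: (hideal_regular hG') => s a ha; rewrite !SE to_coneM of_coneK.
  exact: (graded_regular fm sf gf ggm cop (to_cone_gr q ha)).
have Iof F : V F -> I (to_cone q F) by rewrite /I to_coneK.
have [|V1 [V1E V1sat V1h]] := ratio_scheme (S := S) (V := V) hG hG'.
  move=> s F v hF' hv Vv /Srel; rewrite to_coneM to_coneX /to_cone_var eqxx mul_polyC.
  case/(ratio_saturated ID IM Is fm sf gf If cop (Iof _ Vv) (to_cone_gr q hv)) => w Iw Ew.
  by exists (of_cone q w) => //; apply/Srel; rewrite of_coneK.
have V1S : subscheme V1 S.
  move=> F SF; apply/V1E; exists 0; first exact: hideal0.
  by rewrite mulr0 sub0r; apply: hidealN; apply: hidealM.
have V1rel p y : I p -> f %| gm * p - dlt * y -> V1 (of_cone q y).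
  by move=> Ip Ey; apply/V1E; exists (of_cone q p) => //; apply/Srel; rewrite !of_coneK.
have V1min : least_degree (d.-1 + kap) V1.
  move=> s F VF1 hF1 nz; have [v [Vv hv /Srel Ev]] := V1h s F hF1 VF1.
  apply: (ratio_min fm sf gf gd eD nd low (Iof _ Vv) (to_cone_gr q hv) (to_cone_gr q hF1) Ev).
  by apply: contraNneq nz => z; rewrite -[F](to_coneK q) z rmorph0.
have V1pos : curve_position q d V1.
  split; first by exists F0; split; [apply: V1S | | rewrite Ef].
  have [s [p [y [Ip Ey gy ey]]]] := ratio_avoids IM fm sf gf d0 Id gd eD cop psi.
  exists s, (of_cone q y); split; [exact: V1rel Ey | exact: of_cone_homog | by rewrite of_coneK].
exists h, V1; split=> //.
  exists S; split=> //; first by split=> //; apply: pure_dim0_position V1pos V1min.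
    by split=> //; apply: pure_dim0_position pV mV.
  apply: (linearly_equivalent_ratio hG hG' regG regG'); last by move=> y /V1E.
  move=> a Va; apply: (@homog_ind _ _ (fun a => exists2 y, V1 y & S (G' * a - D * y))).
  - by exists 0; rewrite ?mulr0 ?subrr; apply: hideal0.
  - move=> a1 a2 [b1 V1b1 S1] [b2 V1b2 S2]; exists (b1 + b2); first exact: hidealD.
    rewrite (_ : _ - _ = (G' * a1 - D * b1) + (G' * a2 - D * b2)); last by ring.
    exact: hidealD.
  move=> s; have hs := pihomogP mdeg s a.
  have Ias : I (to_cone q (pihomog mdeg s a)) by apply/Iof/hideal_homog.
  have [y [Ey _]] := psi s _ Ias (to_cone_gr q hs).
  exists (of_cone q y); first exact: V1rel Ias Ey.
  by apply/Srel; rewrite of_coneK.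
exists (of_cone q y1), c; rewrite of_coneK; split=> //; first exact: V1rel Iv1 Ey1.
exact: of_cone_homog.
Qed.

End Descent.

(** * Chains of biliaisons *)

Section Chains.
Variable k : closedFieldType.
Local Notation R := {mpoly k[3]}.
Local Notation X0 := ('X_(0 : 'I_3) : R).
Local Notation X1 := ('X_(1 : 'I_3) : R).
Local Notation X2 := ('X_(2 : 'I_3) : R).

(** Here the last term of the chain is equal to [W], not only the same scheme
    as [W], so that the chain can be prolonged by a biliaison from [W]. *)
Definition chained_from_point (W : closed_subscheme k) : Prop :=
  exists (p : points k 1) (r : nat) (Z : nat -> closed_subscheme k),
    [/\ same_scheme (Z 0%N) (points_scheme p), Z r = W
      & forall i, (i < r)%N -> exists h : nat, elementary_biliaison h%:Z (Z i) (Z i.+1)].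

Lemma chained_step (V W : closed_subscheme k) (h : nat) :
  chained_from_point V -> elementary_biliaison h%:Z V W -> chained_from_point W.
Proof.
move=> [p [r [Z [Z0 <- Zs]]]] hW.
exists p, r.+1, (fun i => if (i <= r)%N then Z i else W); split=> //; first by rewrite /= ltnn.
move=> i; rewrite ltnS => ir; rewrite ir; case: ltnP => [lt | ri]; first exact: Zs.
by exists h; have -> : i = r by apply/eqP; rewrite eqn_leq ir.
Qed.

Lemma to_coneZ q c (F : R) : to_cone q (c *: F) = c%:MP *: to_cone q F.
Proof. by rewrite -mul_mpolyC to_coneM to_coneC mul_polyC. Qed.

Lemma linear_form (F : R) : F \is 1.-homog ->
  exists a b c, F = a *: X0 + b *: X1 + c *: X2.
Proof.
move=> /dhomogP hF; rewrite [F]mpolyE big_seq.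
apply: (big_ind (fun P => exists a b c, P = a *: X0 + b *: X1 + c *: X2)).
- by exists 0, 0, 0; rewrite !scale0r !addr0.
- move=> P Q [a [b [c ->]]] [a' [b' [c' ->]]]; exists (a + a'), (b + b'), (c + c').
  by rewrite -!mul_mpolyC !mpolyCD; ring.
move=> m /hF /= /eqP /mdeg1P [i /eqP ->]; move: (F@_ _) => x.
have [-> | [-> | ->]] : i = 0 \/ i = 1 \/ i = 2%:R.
- by case: i => [[|[|[|//]]] lt]; [left | right; left | right; right]; apply/val_inj.
- by exists x, 0, 0; rewrite !scale0r !addr0.
- by exists 0, x, 0; rewrite !scale0r addr0 add0r.
by exists 0, 0, x; rewrite !scale0r !add0r.
Qed.

Lemma point_scheme_ideal (V : closed_subscheme k) a b :
  V (X1 - a *: X0) -> V (X2 - b *: X0) -> (forall F, V (X0 * F) -> V F) -> ~ V 1 ->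
  exists p : points k 1, same_scheme V (points_scheme p).
Proof.
move=> h1 h2 sV nV1; pose M : 'M[k]_(1, 3) := \row_j affine_point a b j.
have M0 i : row i M != 0.
  apply/eqP => /rowP /(_ 0) /eqP; rewrite !mxE /affine_point eqxx; exact/negP/oner_neq0.
have Md i j : i != j -> ~~ (row i M <= row j M)%MS by rewrite !ord1 eqxx.
exists (Points M0 Md) => F; rewrite /= /vanishing_ideal.
have evM d (i : 'I_1) : (pihomog mdeg d F).@[fun j => M i j]
     = (pihomog mdeg d F).@[affine_point a b].
  by apply: meval_eq => j; rewrite mxE.
have PE d := hideal_eval h1 h2 (pihomogP mdeg d F).
have X0n d : ~ V (X0 ^+ d).
  by elim: d => [|d IH]; rewrite ?expr0 // exprS => /sV.
split=> [VF d i | H].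
  rewrite evM; apply/eqP; apply: contraT => nz; case: (X0n d); apply: (hidealZ_inv nz).
  rewrite -[X in V X](subKr (pihomog mdeg d F)); apply: hidealB => //.
  exact: hideal_homog.
apply: hideal_components => d; have := PE d; rewrite -(evM d 0) H scale0r subr0.
by [].
Qed.

(** Induction on the degree of the curve; the last step, on a line, starts from
    the intersection point of two lines. *)
Lemma chained_position q d (V : closed_subscheme k) :
  curve_position q d.+1 V -> least_degree d.+1 V -> (forall F, V (X0 * F) -> V F) ->
  chained_from_point V.
Proof.
elim: d V => [|d IH] V pV mV sV.
  have [h [V1 [bil [[F0 [VF0 hF0 fm]] _] mV1 sV1 [F [c [VF hF size_evp c0 Fc]]]]]] :=
    descent (kap := 1) pV mV sV (ltn0Sn _) (leqnn _) (leqnn _).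
  apply: chained_step bil.
  have V1Y : V1 (X1 - q *: X2).
    apply: (hidealZ_inv c0); suff <- : F = c *: (X1 - q *: X2) by [].
    apply: (can_inj (to_coneK q)); rewrite to_coneZ to_coneB to_coneZ !to_coneX.
    rewrite /to_cone_var /= mul_polyC addrK [to_cone q F]size1_polyC // Fc expr1.
    by rewrite -mul_polyC -polyCM.
  have [a [b [c' E0]]] := linear_form hF0.
  have Eb : q * b + c' = 1.
    have sz := size_monic_gr fm (to_cone_gr q hF0).
    have := monicP fm; rewrite lead_coefE sz E0 !to_coneD !to_coneZ !to_coneX /to_cone_var /=.
    rewrite !coefD !coefZ !coefC coefD coefC coefCM coefX /= mulr0 add0r add0r !mulr1.
    rewrite -mpolyCM -mpolyCD -mpolyC1 => /eqP; rewrite mpolyC_eq => /eqP.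
    by rewrite mulrC.
  have V1X2 : V1 (X2 - (- a) *: X0).
    have := hidealB VF0 (hidealZ b V1Y); congr (V1 _); rewrite E0.
    have -> : c' = 1 - q * b by rewrite -Eb addrC addKr.
    by rewrite -!mul_mpolyC mpolyCB mpolyCM mpolyCN mpolyC1; ring.
  have V1X1 : V1 (X1 - (- (q * a)) *: X0).
    have := hidealD V1Y (hidealZ q V1X2); congr (V1 _).
    by rewrite -!mul_mpolyC !mpolyCN mpolyCM; ring.
  have [p Vp] := point_scheme_ideal V1X1 V1X2 sV1 (least_degree_nonempty (leqnn _) mV1).
  by exists p, 0%N, (fun=> V1); split.
have [h [V1 [bil [_ [t [D HD]]] mV1 sV1 [F [c [VF hF size_evp c0 Fc]]]]]] :=
  descent (kap := 0) pV mV sV (ltn0Sn _) (leq0n _) (leq0n d).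
rewrite /= addn0 in mV1 hF; rewrite /= expr0 mulr1 in Fc.
apply: chained_step bil; apply: IH => //; split; last by exists t, D.
exists (c^-1 *: F); split; [exact: hidealZ | exact: dhomogZ |].
have top : (to_cone q (c^-1 *: F))`_d.+1 = 1.
  by rewrite to_coneZ coefZ Fc -mpolyCM mulVf // mpolyC1.
apply: monic_gr_top top; apply: to_cone_gr; exact: dhomogZ.
Qed.

End Chains.

(** * Points off a line *)

Lemma dhomog0_const (k : fieldType) n (F : {mpoly k[n]}) :
  F \is 0.-homog -> F = (F@_0%MM)%:MP.
Proof.
move=> /dhomogP hF; apply/mpolyP => m; rewrite mcoeffC.
have [-> | ne] := eqVneq m 0%MM; first by rewrite mulr1.
rewrite mulr0; apply: memN_msupp_eq0; apply: contra_neqN ne => /hF /= /eqP.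
by rewrite mdeg_eq0 => /eqP.
Qed.

Lemma meval0_homog (k : fieldType) n r (b : {mpoly k[n]}) :
  (0 < r)%N -> b \is r.-homog -> b.@[fun=> 0] = 0.
Proof.
move=> r0 /dhomogP hb; rewrite mevalE big1_seq // => m /andP[_ /hb /= mr].
case: (pickP (fun i => m i != 0%N)) => [i mi | m0].
  by rewrite (bigD1 i) //= expr0n (negPf mi) mul0r mulr0.
move: r0; rewrite -mr mdegE big1 // => i _.
by have := m0 i => /negbFE/eqP.
Qed.

Section Start.
Variables (k : closedFieldType) (n : nat) (A : points k n).
Hypotheses (n_gt0 : (0 < n)%N) (A0 : forall i, A i 0 != 0).
Local Notation R := {mpoly k[3]}.
Local Notation X0 := ('X_(0 : 'I_3) : R).
Local Notation X1 := ('X_(1 : 'I_3) : R).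
Local Notation X2 := ('X_(2 : 'I_3) : R).
Let Z := points_scheme A.

Lemma pointsP F : Z F <-> forall i, line_eval A i F = 0.
Proof. exact: vanishing_idealP. Qed.

Lemma line_evalX i j : line_eval A i 'X_j = (A i j)%:P * 'X.
Proof. by rewrite /line_eval mmapX mmap1U. Qed.

Lemma line_evalC i c : line_eval A i c%:MP = c%:P.
Proof. by rewrite /line_eval mmapC. Qed.

Lemma line_evalB i F G : line_eval A i (F - G) = line_eval A i F - line_eval A i G.
Proof. by rewrite /line_eval rmorphB. Qed.

Lemma line_evalZ i c F : line_eval A i (c *: F) = c%:P * line_eval A i F.
Proof. by rewrite -mul_mpolyC line_evalM line_evalC. Qed.

Lemma points_saturated F : Z (X0 * F) -> Z F.
Proof.
move=> /pointsP H; apply/pointsP => i; have /eqP := H i.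
rewrite line_evalM line_evalX !mulf_eq0 polyC_eq0 (negPf (A0 i)) polyX_eq0 /=.
by move/eqP.
Qed.

Lemma points_prod (F : 'I_n -> R) : (forall i, line_eval A i (F i) = 0) ->
  Z (\prod_i F i).
Proof.
move=> H; apply/pointsP => i.
by rewrite (bigD1 i) //= line_evalM H mul0r.
Qed.

Lemma prod_linear_homog (F : 'I_n -> R) : (forall i, F i \is 1.-homog) ->
  exists s, \prod_i F i \is s.-homog.
Proof.
move=> H; apply: (big_ind (fun P : R => exists s, P \is s.-homog)) => //.
- by exists 0%N; apply: dhomog1.
- by move=> P Q [s hP] [r hQ]; exists (s + r)%N; apply: dhomogM.
by move=> i _; exists 1%N.
Qed.

Lemma X_homog (i : 'I_3) : ('X_i : R) \is 1.-homog.
Proof. by rewrite dhomogX /= mdeg1. Qed.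

(** A product of lines, each through one of the points and through
    [(0 : 1 : 0)], contains the points; so some curve of least degree exists. *)
Lemma points_least_degree : exists d F0,
  [/\ F0 != 0, F0 \is d.+1.-homog, Z F0 & least_degree d.+1 Z].
Proof.
have [|d [F0 [nz hF ZF]] mn] := @nat_minimal
  (fun d => exists F : R, [/\ F != 0, F \is d.-homog & Z F]).
  pose F i := A i 0 *: X2 - A i 2%:R *: X0.
  have hF i : F i \is 1.-homog by apply: rpredB; apply: dhomogZ; apply: X_homog.
  have [s hs] := prod_linear_homog hF; exists s, (\prod_i F i); split=> //.
    apply/prodf_neq0 => i _; apply: contraNneq (A0 i) => /(congr1 (mcoeff U_((2%:R)%R : 'I_3)%MM)).
    rewrite mcoeffB !mcoeffZ !mcoeffX mcoeff0 eqxx.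
    rewrite (negPf (_ : U_(ord0)%MM != U_((2%:R)%R : 'I_3)%MM)) ?mulr1 ?mulr0 ?subr0.
      by move=> ->.
    by apply/eqP => /mnmP /(_ ord0); rewrite !mnm1E.
  apply: points_prod => i; rewrite line_evalB !line_evalZ !line_evalX.
  by rewrite mulrCA !mulrA subrr.
case: d hF mn => [|d] hF mn.
  case/eqP: nz; rewrite (dhomog0_const hF); apply/eqP; rewrite mpolyC_eq0 -polyC_eq0.
  move/pointsP: ZF => /(_ (Ordinal n_gt0)); rewrite {1}(dhomog0_const hF) line_evalC.
  by move=> ->.
exists d, F0; split=> // s F ZF' hF' nz'; apply: mn; by exists F.
Qed.

(** The centers of projection on the line [X_0 = 0]. *)
Definition infinity_point (q : k) (i : 'I_3) : k :=
  if i == 0 then 0 else if i == 1 then q else 1.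

(** A curve of least degree through the points does not contain the line
    [X_0 = 0], since removing this line would leave a curve through the points;
    a center of projection can thus be chosen off the curve. *)
Lemma projection_exists d F0 : F0 != 0 -> F0 \is d.+1.-homog -> Z F0 ->
  least_degree d.+1 Z -> exists q, F0.@[infinity_point q] != 0.
Proof.
move=> nz hF ZF mn; pose v (i : 'I_3) : {poly k} := if i == 0 then 0 else if i == 1 then 'X else 1.
have /dhomogP hF' := hF.
suff nzp : mmap (@polyC k) v F0 != 0.
  have /closed_nonrootP [q rq] := nzp; exists q; move: rq; rewrite /root; congr (_ != _).
  apply: (mpoly_morph_ext (g := horner_eval q \o mmap (@polyC k) v)
     (h := meval (infinity_point q))) => [c|i] /=.
    by rewrite mmapC mevalC /horner_eval hornerC.
  rewrite mmapX mmap1U mevalXU /horner_eval /v /infinity_point.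
  by case: eqP => _; rewrite ?hornerC //; case: eqP => _; rewrite ?hornerX ?hornerC.
have [m mF m0] : exists2 m, m \in msupp F0 & m 0 = 0%N.
  apply: NNPP => H; have [|F' E] := @mpoly_divX _ _ 0 F0.
    by move=> m mF; apply/eqP => m0; apply: H; exists m.
  move: hF; rewrite E => /dhomog_mulX [F0' | [s [<-] hF1]].
    by case/eqP: nz; rewrite E F0' mulr0.
  have /mn/(_ hF1) : Z F' by apply: points_saturated; rewrite -E.
  have F'0 : F' != 0 by apply: contraNneq nz => F'0; rewrite E F'0 mulr0.
  by move/(_ F'0); rewrite ltnn.
have mdegE3 (m' : 'X_{1..3}) : mdeg m' = (m' 0%R + m' 1%R + m' (2%:R)%R)%N.
  rewrite mdegE !big_ord_recl big_ord0 addn0 -addnA.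
  by congr (m' _ + (m' _ + m' _))%N; apply/val_inj.
have mv m' : mmap1 v m' = (m' 0 == 0%N)%:R * 'X^(m' 1).
  rewrite /mmap1 !big_ord_recl big_ord0 mulr1 /v /= expr0n.
  rewrite expr1n mulr1; congr (_ * 'X^(m' _)); exact/val_inj.
apply/eqP => /(congr1 (fun p : {poly k} => p`_(m 1))); rewrite coef0 /mmap coef_sum.
rewrite (bigD1_seq m) //= [X in _ + X]big1_seq ?addr0 => [|m' /andP[ne m'F]].
  rewrite mv m0 eqxx mul1r coefCM coefXn eqxx mulr1 => /eqP.
  by rewrite mcoeff_eq0 mF.
rewrite mv coefCM; case: eqP => m'0; last by rewrite mul0r coef0 mulr0.
rewrite mul1r coefXn; case: eqP => m1; last by rewrite mulr0.
case/eqP: ne; have /= := hF' _ m'F; have /= <- := hF' _ mF.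
rewrite !mdegE3 m0 m'0 m1 => /eqP; rewrite eqn_add2l => /eqP m2.
apply/mnmP => i; have [-> | [-> | ->]] : i = 0 \/ i = 1 \/ i = 2%:R; rewrite ?m0 //.
by case: i => [[|[|[|//]]] lt]; [left | right; left | right; right]; apply/val_inj.
Qed.

(** The curve is monic in [X_2], up to a scalar, when it does not contain the
    center of projection. *)
Lemma to_cone_top q d (F0 : R) : F0 \is d.-homog ->
  (to_cone q F0)`_d = (F0.@[infinity_point q])%:MP.
Proof.
move=> hF; have gf := to_cone_gr q hF.
have h0 : (to_cone q F0)`_d \is 0.-homog.
  by have := gr_coef (leqnn d) gf; rewrite subnn.
rewrite (dhomog0_const h0); congr (_%:MP).
have -> : ((to_cone q F0)`_d)@_0%MM = ((to_cone q F0)`_d).@[fun=> 0].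
  by rewrite [in RHS](dhomog0_const h0) mevalC.
pose E (p : {poly {mpoly k[2]}}) := (map_poly (meval (fun=> 0)) p).[1].
have -> : F0.@[infinity_point q] = E (to_cone q F0).
  apply: (mpoly_morph_ext (g := meval (infinity_point q))
    (h := horner_eval 1 \o map_poly (meval (fun=> 0)) \o to_cone q)) => [c|i] /=.
    by rewrite to_coneC map_polyC /horner_eval hornerC /= !mevalC.
  rewrite mevalXU to_coneX /to_cone_var /infinity_point; case: eqP => _.
    by rewrite map_polyC /horner_eval hornerC /= mevalXU.
  case: eqP => _; last by rewrite map_polyX /horner_eval hornerX.
  rewrite rmorphD rmorphM /= !map_polyC map_polyX /horner_eval.
  by rewrite hornerD hornerM !hornerC hornerX /= mevalXU mevalC add0r mulr1.
rewrite /E (horner_coef_wide (n := d.+1)); last first.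
  exact: leq_trans (size_poly _ _) (size_gr gf).
rewrite big_ord_recr big1 /= => [|i _].
  by rewrite add0r expr1n mulr1 coef_map.
rewrite expr1n mulr1 coef_map; have id := ltn_ord i.
by apply: (@meval0_homog _ _ (d - i)); [rewrite subn_gt0 | apply: gr_coef => //; apply: ltnW].
Qed.

Lemma points_position : exists q d,
  curve_position q d.+1 Z /\ least_degree d.+1 Z.
Proof.
have [d [F0 [nz hF ZF mn]]] := points_least_degree.
have [q] := projection_exists nz hF ZF mn; set c := meval _ _ => c0.
exists q, d; split=> //; split.
  exists (c^-1 *: F0); split; [exact: hidealZ | exact: dhomogZ |].
  apply: (monic_gr_top (d := d.+1)); first by apply: to_cone_gr; apply: dhomogZ.
  by rewrite to_coneZ coefZ (to_cone_top _ hF) -mpolyCM mulVf // mpolyC1.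
(* The form [D] is a product of lines joining the center of projection to the
   points. *)
pose e i := (A i 1 - q * A i 2%:R) / A i 0.
pose F i := (X1 - q *: X2) - e i *: X0.
have hFi i : F i \is 1.-homog.
  by apply: rpredB; [apply: rpredB |]; do ?apply: dhomogZ; apply: X_homog.
have [t ht] := prod_linear_homog hFi; exists t, (\prod_i F i); split=> //.
  apply: points_prod => i; rewrite !line_evalB !line_evalZ !line_evalX.
  rewrite !mulrA -!polyCM -!mulrBl -!polyCB /e.
  by rewrite divfK // subrr mul0r.
rewrite (big_morph (to_cone q) (to_coneM q) (id1 := 1)) ?rmorph1 //.
rewrite (big_morph (@evp k) (@evpM k) (id1 := 1)) ?rmorph1 // big1 // => i _.
rewrite !to_coneB !to_coneZ !to_coneX /to_cone_var /= mul_polyC addrK evpB evpZ.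
rewrite /evp !map_polyC /= -!/(ev _) ev_x1 ev_x0 scale_polyC mulr0 subr0.
by [].
Qed.

End Start.

Lemma distinct_scalars (k : closedFieldType) n : exists2 s : seq k, uniq s & size s = n.
Proof.
elim: n => [|n [s us ss]]; first by exists [::].
have /closed_nonrootP [x] : \prod_(a <- s) ('X - a%:P) != 0.
  exact/monic_neq0/monic_prod_XsubC.
by rewrite root_prod_XsubC => xs; exists (x :: s); rewrite /= ?xs ?ss.
Qed.

Theorem proposition2p1 (k : closedFieldType) (n : nat) (hn : (1 <= n)%N) :
  general_points_have (fun Z : points k n =>
    exists p : points k 1,
      ascending_biliaisons (points_scheme p) (points_scheme Z)).
Proof.
exists (fun A => forall i, A i 0 != 0); split.
- split.
    move=> A B [_ AB] A0 j; have [i /andP[/sub_rVP [c Ec] _]] := AB j.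
    have := A0 i; apply: contraNneq => B0.
    by have /rowP/(_ 0) := Ec; rewrite !mxE B0 mulr0 => ->.
  (* The product of the [X_0]-coordinates is a single monomial, so it is
     multihomogeneous. *)
  exists (fun F => F = \prod_i 'X_(mxvec_index i 0)); split.
    move=> F ->; pose m := (\sum_(i < n) U_(mxvec_index i (ord0 : 'I_3)))%MM.
    exists (fun i => \sum_(j < 3) m (mxvec_index i j))%N => m'.
    by rewrite mprodXE msuppX inE => /eqP ->.
  have ev (A : points k n) : eval_points (\prod_i 'X_(mxvec_index i 0)) A = \prod_i A i 0.
    rewrite /eval_points rmorph_prod; apply: eq_bigr => i _.
    by rewrite /= mevalXU mxvecE.
  move=> A; split=> [A0 | [F [-> ]]].
    by exists (\prod_i 'X_(mxvec_index i 0)); split=> //; rewrite ev; apply/prodf_neq0.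
  by rewrite ev => /prodf_neq0 H i; apply: H.
- have [s us ss] := distinct_scalars k n.
  pose M : 'M[k]_(n, 3) := \matrix_(i, j) if j == 0 then 1 else if j == 1 then s`_i else 0.
  have M0 i : row i M != 0.
    by apply/eqP => /rowP /(_ 0) /eqP; rewrite !mxE eqxx oner_eq0.
  have Md i j : i != j -> ~~ (row i M <= row j M)%MS.
    apply: contra => /sub_rVP [c Ec]; have /rowP/(_ 0) := Ec; have /rowP/(_ 1) := Ec.
    rewrite !mxE /= mulr1 => E c1; move: E; rewrite -c1 mul1r => /eqP.
    by rewrite nth_uniq ?ss.
  by exists (Points M0 Md) => i; rewrite /= mxE eqxx oner_neq0.
move=> A A0; have [q [d [pos least]]] := points_position hn A0.
have [p [r [Z [Z0 Zr Zs]]]] := chained_position pos least (points_saturated A0).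
exists p, r, Z; split=> //; first by rewrite Zr.
by move=> i /Zs [h hb]; exists h%:Z.
Qed.
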